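(* Let $0<s<1$, $q>0$ and $z\in\mathbb{C}\setminus\mathbb{R}$, and consider on the real axis the external field $$Q(x)=-\frac{q}{|x-z|^{s}},\qquad x\in\mathbb{R}.$$ Consider the Gauss variational problem of minimizing the weighted Riesz $s$-energy $$I_Q(\nu)=\iint\frac{d\nu(x)\,d\nu(y)}{|x-y|^{s}}+2\int Q(x)\,d\nu(x)$$ over all Borel probability measures $\nu$ supported on $\mathbb{R}$. Then: (1) if $q>1$, there exists a unique equilibrium measure $\mu_Q$ (minimizer), and its support $S_Q=\operatorname{supp}\mu_Q$ is a compact interval of the real axis; (2) if $q<1$, the equilibrium measure does not exist.
   Context: For a measure $\sigma$ on $\mathbb{R}$, its Riesz $s$-potential is $U_s^{\sigma}(x)=\int|x-y|^{-s}\,d\sigma(y)$. The equilibrium measure $\mu_Q$ (when it exists) is the minimizer of $I_Q$ among probability measures on $\mathbb{R}$; it is characterized by the Frostman conditions: for some constant $F_Q$, $U_s^{\mu_Q}(x)+Q(x)\ge F_Q$ quasi-everywhere on $\mathbb{R}$ (i.e. outside a set of zero Riesz $s$-capacity) and $U_s^{\mu_Q}(x)+Q(x)\le F_Q$ everywhere on $\operatorname{supp}\mu_Q$. *)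

(* Defs.v *)
From HB Require Import structures.
From mathcomp Require Import all_boot all_order all_algebra.
From mathcomp Require Import all_classical all_reals all_analysis.
Set Implicit Arguments. Unset Strict Implicit. Unset Printing Implicit Defensive.
Import Order.TTheory GRing.Theory Num.Theory.
Import numFieldNormedType.Exports.
Local Open Scope classical_set_scope.
Local Open Scope ring_scope.

Definition riesz_kernel (R : realType) (s : R) (x y : R) : \bar R :=
  if x == y then +oo%E else ((`|x - y|) `^ (- s))%:E.

(* Riesz s-energy  I(nu) = \iint |x-y|^{-s} dnu(x) dnu(y)  (iterated integral of a
   nonnegative kernel, equal to the product-measure integral by Tonelli). *)
Definition riesz_energy (R : realType) (s : R) (nu : probability R R) : \bar R :=
  (\int[nu]_x \int[nu]_y riesz_kernel s x y)%E.

(* External field Q(x) = - q / |x - z|^s with z = a + i b (b <> 0),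
   |x - z| = sqrt((x-a)^2 + b^2). *)
Definition ext_field (R : realType) (s q a b : R) (x : R) : R :=
  - q * (Num.sqrt ((x - a) ^+ 2 + b ^+ 2)) `^ (- s).

Definition weighted_energy (R : realType) (s q a b : R) (nu : probability R R)
  : \bar R :=
  (riesz_energy s nu + 2%:E * \int[nu]_x (ext_field s q a b x)%:E)%E.

Definition is_equilibrium (R : realType) (s q a b : R) (mu : probability R R)
  : Prop :=
  forall nu : probability R R,
    (weighted_energy s q a b mu <= weighted_energy s q a b nu)%E.

Definition msupport (R : realType) (mu : probability R R) : set R :=
  [set x : R | forall e : R, 0 < e -> (0%E < mu `](x - e)%R, (x + e)%R[%classic)%E].

(* Main.v *)
Require Import Defs.
From HB Require Import structures.
From mathcomp Require Import all_boot all_order all_algebra.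
From mathcomp Require Import all_classical all_reals all_analysis measurable_realfun.
From mathcomp Require Import ring lra.
Set Implicit Arguments. Unset Strict Implicit. Unset Printing Implicit Defensive.
Import Order.TTheory GRing.Theory Num.Theory.
Import numFieldNormedType.Exports.
Local Open Scope classical_set_scope.
Local Open Scope ring_scope.

(* The kernel [|x - y|^(-s)] is the scalar product of weighted indicators of the
   windows [t < x <= t + r] in L2(dr dt), so the energy of a measure [nu] is the
   squared L2 norm of its trace [f_nu (r, t) ~ nu ]t, t + r]], which determines
   [nu].  The inversion centred at [x] that maps [z] to its conjugate shows that
   the probability [sigma] of density proportional to [|y - z|^(s - 2)] has
   potential [|x - z|^(-s)] on the line.  Hence, up to a constant, the weighted
   energy is [|f_nu - q f_sigma|^2], and the problem is a projection of
   [q sigma] onto the probability measures.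

   Helly's theorem and Fatou's lemma give a minimizer among sub-probabilities.
   If [q > 1] it has full mass, it is unique by strict convexity, and the first
   variation gives the Frostman inequalities with a constant [- c < 0].  That sign
   bounds the support; and in a gap of the support, convexity of [t^(-s)] makes
   the inequalities at the two endpoints strict in between, contradicting the
   opposite inequality, which holds on a dense set.

   If [q < 1], adding to [q sigma] the mass [1 - q], dilated towards infinity,
   drives the weighted energy to its infimum, attained only by [q sigma], which is
   not a probability. *)

(** The windows come from a classical fact: a convex decreasing function vanishing at infinity is a
    mixture of triangles max(0, r - |x - y|), and each triangle is the autocorrelation of the
    indicator of an interval of length r. Working with traces avoids the energy of signed measures,
    where infinity minus infinity could occur: subtraction takes place in L2. It also makes
    injectivity elementary, since a trace records the masses of intervals.

    The threshold 1 is the mass of [sigma]: sweeping the unit charge onto the line loses nothing. At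
    q = 1 the projection is [sigma] itself, whose support is the whole line, so that value belongs
    to neither regime.

    Exceptional sets in the Frostman inequalities are handled by testing with [sigma] and the
    minimizer, both of finite energy, in place of capacity. *)

Definition leb (R : realType) : set R -> \bar R :=
  pushforward (@lebesgue_measure R) (idfun : measurableTypeR R -> R).

(** * Lebesgue measure on the line and on the plane *)

Section lebesgue_measure_on_R.
Variable R : realType.
Local Notation leb := (@leb R).

Let leb0 : leb set0 = 0%E.
Proof. exact: (@measure0 _ _ _ (@lebesgue_measure R)). Qed.

Let leb_ge0 A : (0 <= leb A)%E.
Proof. exact: (@measure_ge0 _ _ _ (@lebesgue_measure R)). Qed.

Let leb_sigma_additive : semi_sigma_additive leb.
Proof. exact: (@measure_semi_sigma_additive _ _ _ (@lebesgue_measure R)). Qed.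

HB.instance Definition _ :=
  isMeasure.Build _ _ _ leb leb0 leb_ge0 leb_sigma_additive.

Let leb_sigma_finite : sigma_finite setT leb.
Proof. exact: (@sigma_finiteT _ _ _ (@lebesgue_measure R)). Qed.

HB.instance Definition _ := Measure_isSigmaFinite.Build _ _ _ leb leb_sigma_finite.

(** Bridge to calculus: the fundamental theorem and the change of variables are stated for
    [lebesgue_measure], on [measurableTypeR R], whereas the probabilities of the theorem live on
    [R]. *)
Lemma ge0_integral_leb (D : set R) (f : R -> \bar R) : measurable D ->
  measurable_fun D f -> (forall x, D x -> 0 <= f x)%E ->
  (\int[leb]_(x in D) f x = \int[lebesgue_measure]_(x in D) f x)%E.
Proof.
move=> mD mf f0; rewrite ge0_integral_pushforward//; first exact: measurable_id.
by move=> y; rewrite inE; exact: f0.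
Qed.

Lemma leb_itvoo (u v : R) : u < v -> leb `]u, v[%classic = (v - u)%:E.
Proof.
move=> uv; transitivity (@lebesgue_measure R `]u, v[%classic) => //.
by rewrite lebesgue_measure_itv/= lte_fin uv -EFinB.
Qed.

Definition leb2 : set (R * R) -> \bar R := (leb \x leb)%E.

HB.instance Definition _ := Measure.copy leb2 (leb \x leb)%E.

Let leb2_sigma_finite : sigma_finite setT leb2.
Proof.
exists (fun n : nat => `](- n%:R)%R, n%:R[%classic `*` `](- n%:R)%R, n%:R[%classic).
  apply/seteqP; split => // -[x y] _.
  exists (maxn (Num.bound `|x|) (Num.bound `|y|)) => //=.
  rewrite !in_itv/= -!ltr_norml !(lt_le_trans (archi_boundP (normr_ge0 _)))//;
    by rewrite ler_nat ?leq_maxl ?leq_maxr.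
move=> n; split; first exact: measurableX.
have h : (leb `](- n%:R)%R, n%:R[%classic < +oo)%E.
  have [/leb_itvoo ->|n0] := ltP (- n%:R : R) n%:R; first by rewrite ltry.
  by rewrite set_itv_ge ?bnd_simp -?leNgt// measure0.
by rewrite /leb2 product_measure1E// lte_mul_pinfty// ge0_fin_numE.
Qed.

HB.instance Definition _ := Measure_isSigmaFinite.Build _ _ _ leb2 leb2_sigma_finite.

End lebesgue_measure_on_R.

(** * Real powers and elementary properties of the Riesz kernel *)

Section power_functions.
Variable R : realType.
Implicit Types (p s x y d : R).

Lemma cvgy_powRN p : 0 < p -> x `^ (- p) @[x --> +oo] --> (0 : R).
Proof.
move=> p0; apply/cvgrPdist_le => e e0; near=> x.
rewrite sub0r normrN ger0_norm ?powR_ge0// powRN.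
have x0 : 0 < x by near: x; exact: nbhs_pinfty_gt.
rewrite -[leRHS]invrK lef_pV2 ?posrE ?powR_gt0 ?invr_gt0//.
have -> : e^-1 = (e^-1 `^ p^-1) `^ p.
  by rewrite -powRrM mulVf ?gt_eqF// powRr1// invr_ge0 ltW.
have xe : e^-1 `^ p^-1 <= x by near: x; exact: nbhs_pinfty_ge.
by apply: ge0_ler_powR; rewrite ?nnegrE ?powR_ge0 ?ltW.
Unshelve. all: by end_near. Qed.

Lemma powRB1 x p : 0 < x -> x `^ (p - 1) = x `^ p / x.
Proof.
by move=> x0; rewrite powRB ?powRr1 ?ltW// (gt_eqF x0) implybT.
Qed.

Lemma continuous_powR p x : 0 < x -> {for x, continuous (@powR R ^~ p)}.
Proof.
move=> x0; apply: differentiable_continuous; apply/derivable1_diffP.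
by apply: derivable_powR; rewrite in_itv/= x0.
Qed.

(* the antiderivative is [s d r^(-s-1) - (s + 1) r^(-s)] *)
Lemma integral_riesz_window s d : 0 < s -> 0 < d ->
  (\int[lebesgue_measure]_(r in `[d, +oo[) (s * (s + 1) * r `^ (- s - 2) * (r - d))%:E
   = (d `^ (- s))%:E)%E.
Proof.
move=> s0 d0.
pose F (r : R) : R := s * d * r `^ (- (s + 1)) - (s + 1) * r `^ (- s).
have dF (x : R) : 0 < x ->
   is_derive x 1 F (s * d * (- (s + 1) * x `^ (- (s + 1) - 1)) - (s + 1) * (- s * x `^ (- s - 1))).
  move=> x0; rewrite /F.
  have h1 := is_derive1_powR (- (s + 1)) x0.
  have h2 := is_derive1_powR (- s) x0.
  apply: is_deriveB.
have cF x : 0 < x -> {for x, continuous F}.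
  move=> x0; apply: differentiable_continuous; apply/derivable1_diffP.
  by have [] := dF _ x0.
rewrite (@ge0_continuous_FTC2y _ _ F d 0).
- rewrite sub0e -EFinN; congr EFin; rewrite /F opprB.
  have -> : - (s + 1) = - s - 1 by ring.
  rewrite powRB1//.
  by field; rewrite gt_eqF.
- by move=> x dx; rewrite !mulr_ge0 ?powR_ge0 ?subr_ge0 ?addr_ge0 ?(ltW s0).
- apply: derivable_within_continuous => x; rewrite in_itv/= andbT => dx.
  have x0 : 0 < x by exact: lt_le_trans dx.
  have h := is_derive1_powR (- s - 2) x0.
  by apply: derivableM; [apply: derivableM => //; apply: derivable_powR; rewrite in_itv/= x0|].
- rewrite -[0]subr0 -{1}[0](mulr0 (s * d)) -{2}[0](mulr0 (s + 1)).
  by apply: cvgB; (apply: cvgM; first exact: cvg_cst);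
    apply: cvgy_powRN; rewrite ?addr_gt0.
- move=> x dx; have [] // := dF x (lt_trans d0 dx).
- by apply: cvg_at_right_filter; exact: cF.
- move=> x; rewrite in_itv/= andbT => dx; have x0 := lt_trans d0 dx.
  have [_ h] := dF _ x0; rewrite derive1E h.
  have -> : - (s + 1) - 1 = - s - 2 by ring.
  have -> : x `^ (- s - 1) = x `^ (- s - 2) * x.
    have -> : - s - 2 = - s - 1 - 1 by ring.
    by rewrite [in RHS]powRB1// divfK// gt_eqF.
  ring.
Qed.
End power_functions.

Section riesz_kernel_lemmas.
Variables (R : realType) (s : R).

Lemma riesz_kernel_ge0 (x y : R) : (0 <= riesz_kernel s x y)%E.
Proof. by rewrite /riesz_kernel; case: ifP => // _; rewrite lee_fin powR_ge0. Qed.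

Lemma measurable_riesz_kernel :
  measurable_fun setT (fun z : R * R => riesz_kernel s z.1 z.2).
Proof.
apply: measurable_fun_ifT => //; first exact: measurable_fun_eqr.
apply/measurable_EFinP.
apply: (@measurableT_comp _ _ _ _ _ _ (@powR R ^~ (- s))) => //.
apply: (@measurableT_comp _ _ _ _ _ _ (fun u : R => `|u|)) => //.
exact: measurable_funB.
Qed.

Lemma measurable_riesz_kernel1 x : measurable_fun setT (riesz_kernel s x).
Proof.
exact: (measurableT_comp measurable_riesz_kernel (measurable_pair1 x)).
Qed.

End riesz_kernel_lemmas.

(** * The Riesz kernel as a Gram kernel *)

Section window_kernel.
Variables (R : realType) (s : R).
Hypothesis s_gt0 : 0 < s.
Local Notation leb := (@leb R).
Local Notation leb2 := (@leb2 R).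

(* Weight making the scalar product of the windows of [x] and [y] equal to
   [|x - y|^(-s)]: its square is the second derivative of [r^(-s)], and the
   length of starting points shared at scale [r] is [max 0 (r - |x - y|)]. *)
Definition window_weight (r : R) : R :=
  if 0 < r then Num.sqrt (s * (s + 1) * r `^ (- s - 2)) else 0.

Definition window (x : R) (p : R * R) : R :=
  window_weight p.1 * (p.2 < x <= p.2 + p.1)%R%:R.

Lemma window_weight_ge0 r : 0 <= window_weight r.
Proof. by rewrite /window_weight; case: ifP => // _; exact: sqrtr_ge0. Qed.

Lemma window_weight_gt0 r : 0 < r -> 0 < window_weight r.
Proof.
by move=> r0; rewrite /window_weight r0 sqrtr_gt0 !mulr_gt0 ?powR_gt0 ?addr_gt0.
Qed.

Lemma window_weight_sqr r : 0 < r ->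
  window_weight r ^+ 2 = s * (s + 1) * r `^ (- s - 2).
Proof.
move=> r0; rewrite /window_weight r0 sqr_sqrtr//.
by rewrite !mulr_ge0 ?powR_ge0 ?addr_ge0 ?(ltW s_gt0).
Qed.

Lemma window_ge0 x p : 0 <= window x p.
Proof. by rewrite mulr_ge0 ?window_weight_ge0. Qed.

Lemma measurable_window_weight : measurable_fun setT window_weight.
Proof.
rewrite /window_weight; apply: measurable_fun_ifT.
- exact: measurable_fun_ltr.
- apply: (measurableT_comp (continuous_measurable_fun (@sqrt_continuous R))).
  apply: measurable_funM => //; exact: measurable_powR.
- exact: measurable_cst.
Qed.

Lemma measurable_window :
  measurable_fun setT (fun z : R * (R * R) => window z.1 z.2).
Proof.
have m1 : measurable_fun setT (fun z : R * (R * R) => z.2.1).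
  exact: (measurableT_comp measurable_fst measurable_snd).
have m2 : measurable_fun setT (fun z : R * (R * R) => z.2.2).
  exact: (measurableT_comp measurable_snd measurable_snd).
apply: measurable_funM.
  exact: (measurableT_comp measurable_window_weight m1).
rewrite (_ : (fun _ => _) = (fun z : R * (R * R) =>
   if z.2.2 < z.1 <= z.2.2 + z.2.1 then 1 else 0)); last first.
  by apply/funext => z; case: ifP.
apply: measurable_fun_ifT => //.
by apply: measurable_and; [apply: measurable_fun_ltr|apply: measurable_fun_ler => //;
  apply: measurable_funD].
Qed.

Lemma measurable_window1 x : measurable_fun setT (window x).
Proof.
exact: (measurableT_comp measurable_window (measurable_pair1 x)).
Qed.

Lemma measurable_window2 p : measurable_fun setT (window ^~ p).
Proof.
exact: (measurableT_comp measurable_window (measurable_pair2 p)).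
Qed.

(** The scalar product of the windows of two points at distance [d], once the starting points have
    been integrated out. *)
Let phi (d : R) : \bar R := (\int[leb]_r
  (if 0 < r then s * (s + 1) * r `^ (- s - 2) * Num.max 0 (r - d) else 0)%:E)%E.

Let phi_fun_ge0 d r :
  0 <= (if 0 < r then s * (s + 1) * r `^ (- s - 2) * Num.max 0 (r - d) else 0).
Proof.
case: ifP => // r0; rewrite !mulr_ge0 ?powR_ge0 ?addr_ge0 ?(ltW s_gt0)//.
by rewrite le_max lexx.
Qed.

Let phi_fun_meas d : measurable_fun setT (fun r : R =>
  (if 0 < r then s * (s + 1) * r `^ (- s - 2) * Num.max 0 (r - d) else 0)).
Proof.
apply: measurable_fun_ifT => //.
- exact: measurable_fun_ltr.
- apply: measurable_funM.
    by apply: measurable_funM => //; exact: measurable_powR.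
  apply: measurable_maxr => //; exact: measurable_funB.
Qed.

Let phi_gt0 d : 0 < d -> phi d = (d `^ (- s))%:E.
Proof.
move=> d0; rewrite -integral_riesz_window// /phi.
rewrite -ge0_integral_leb//.
- rewrite [RHS]integral_mkcond; apply: eq_integral => r _.
  rewrite patchE mem_setE in_itv/= andbT; case: (leP d r) => dr.
    by rewrite (lt_le_trans d0 dr) max_r ?subr_ge0.
  by case: ifP => // _; rewrite max_l ?mulr0// subr_le0 ltW.
- apply/measurable_EFinP; apply: measurable_funM.
    by apply: measurable_funM => //; apply: measurable_funTS; exact: measurable_powR.
  exact: measurable_funB.
- move=> r; rewrite /= in_itv/= andbT => dr.
  by rewrite lee_fin !mulr_ge0 ?powR_ge0 ?subr_ge0 ?addr_ge0 ?(ltW s_gt0).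
Qed.

(** [phi] is nonincreasing and [phi d] = d^(-s) takes every positive value [M], so [phi 0] exceeds
    them all. This matches the value of the kernel on the diagonal. *)
Let phi0 : phi 0 = +oo%E.
Proof.
apply/eqyP => M M0.
have d0 : 0 < M `^ (- s^-1) by exact: powR_gt0.
have -> : M = (M `^ (- s^-1)) `^ (- s).
  by rewrite -powRrM mulrNN mulVf ?gt_eqF// powRr1// ltW.
rewrite -phi_gt0//; apply: ge0_le_integral => //.
- by move=> r _; rewrite lee_fin.
- by apply/measurable_EFinP.
- by apply/measurable_EFinP.
- move=> r _; rewrite lee_fin; case: ifP => // r0.
  rewrite ler_wpM2l ?mulr_ge0 ?powR_ge0 ?addr_ge0 ?(ltW s_gt0)//.
  by rewrite ge_max !le_max lexx/= lerD2l lerN2 (ltW d0) orbT.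
Qed.

Let phiE x y : phi `|x - y| = riesz_kernel s x y.
Proof.
rewrite /riesz_kernel; have [->|xy] := eqVneq x y.
  by rewrite subrr normr0 phi0.
by rewrite phi_gt0// normr_gt0 subr_eq0.
Qed.

Let window_mul x y r t : x <= y -> window x (r, t) * window y (r, t) =
  (if 0 < r then s * (s + 1) * r `^ (- s - 2) else 0) *
  \1_(`[y - r, x[%classic : set R) t.
Proof.
move=> xy; rewrite /window/= mulrACA -expr2 indicE -natrM mulnb.
case: ifPn => r0; last by rewrite /window_weight (negbTE r0) expr0n !mul0r.
rewrite window_weight_sqr//; congr (_ * (nat_of_bool _)%:R).
rewrite mem_setE in_itv/=; apply/idP/idP; lra.
Qed.

Let integral_window_le x y : x <= y ->
  (\int[leb2]_p (window x p * window y p)%:E = riesz_kernel s x y)%E.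
Proof.
move=> xy; rewrite /leb2 fubini_tonelli1; last 2 first.
- by apply/measurable_EFinP; apply: measurable_funM; exact: measurable_window1.
- by move=> p; rewrite lee_fin mulr_ge0 ?window_ge0.
rewrite -phiE /phi; apply: eq_integral => r _; rewrite /fubini_F.
under eq_integral do rewrite window_mul// EFinM.
rewrite ge0_integralZl//; last 2 first.
- by apply/measurable_EFinP; exact: measurable_indic.
- by rewrite lee_fin; case: ifP => // _; rewrite !mulr_ge0 ?powR_ge0 ?addr_ge0 ?(ltW s_gt0).
rewrite integral_indic// setIT.
set I := (X in (_ * X)%E); have {I}-> : I = (Num.max 0 (r - `|x - y|))%:E.
  transitivity (@lebesgue_measure R `[(y - r)%R, x[%classic) => //.
  rewrite lebesgue_measure_itv/= lte_fin distrC ger0_norm ?subr_ge0// -EFinB.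
  case: ltP => h; congr EFin.
    by rewrite max_r; lra.
  by rewrite max_l; lra.
by rewrite -EFinM; case: ifP => // _; rewrite mul0r.
Qed.

Lemma integral_window x y :
  (\int[leb2]_p (window x p * window y p)%:E = riesz_kernel s x y)%E.
Proof.
have [/integral_window_le//|/ltW yx] := leP x y.
under eq_integral do rewrite mulrC.
by rewrite integral_window_le// /riesz_kernel eq_sym distrC.
Qed.

End window_kernel.

(** * Balayage of the charge onto the line *)

Section point_charge.
Variables (R : realType) (a b : R).
Hypothesis b_neq0 : b != 0.

Definition dist_charge (x : R) : R := Num.sqrt ((x - a) ^+ 2 + b ^+ 2).
Local Notation N := dist_charge.

Lemma dist_charge_sqr x : N x ^+ 2 = (x - a) ^+ 2 + b ^+ 2.
Proof. by rewrite sqr_sqrtr// addr_ge0 ?sqr_ge0. Qed.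

Lemma dist_charge_gt0 x : 0 < N x.
Proof. by rewrite sqrtr_gt0 ltr_wpDl ?sqr_ge0// exprn_even_gt0. Qed.
Local Hint Resolve dist_charge_gt0 : core.

Lemma continuous_dist_charge : continuous N.
Proof.
move=> x; apply: (@continuous_comp _ _ _ (fun y : R => (y - a) ^+ 2 + b ^+ 2)
  (@Num.sqrt R)); last exact: sqrt_continuous.
apply: cvgD; last exact: cvg_cst.
apply: (@continuous_comp _ _ _ (fun y : R => y - a) (fun y => y ^+ 2)).
  by apply: cvgB => //; exact: cvg_cst.
exact: sqr_continuous.
Qed.

Lemma continuous_dist_charge_powR p : continuous (fun x => N x `^ p).
Proof.
move=> x; apply: (@continuous_comp _ _ _ N (@powR R ^~ p)).
  exact: continuous_dist_charge.
exact: continuous_powR.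
Qed.

Lemma measurable_dist_charge_powR p : measurable_fun setT (fun x => N x `^ p).
Proof. by apply: continuous_measurable_fun; exact: continuous_dist_charge_powR. Qed.

Lemma dist_charge_sub x : `|x - a| <= N x.
Proof.
by rewrite -sqrtr_sqr ler_sqrt ?addr_ge0 ?sqr_ge0// lerDl sqr_ge0.
Qed.

Lemma dist_charge_ge x : `|b| <= N x.
Proof.
by rewrite -sqrtr_sqr ler_sqrt ?addr_ge0 ?sqr_ge0// lerDr sqr_ge0.
Qed.

Section inversion.
Variables (s x : R).

(* inversion of the line centred at [x] that exchanges the charge and its
   mirror image *)
Let F (y : R) : R := x + N x ^+ 2 / (y - x).
Let dF (y : R) : R := - (N x ^+ 2 / (y - x) ^+ 2).
Let G (y : R) : R := `|x - y| `^ (- s) * N y `^ (s - 2).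

(** An inversion of radius r centred at x multiplies the distance of y and z by r^2 / (|y - x| |z -
    x|); here r = |z - x| = [N x], so the charge lies on the circle of inversion. *)
Let dist_F y : y != x -> N (F y) = N x * N y / `|y - x|.
Proof.
move=> yx; have yx0 : y - x != 0 by rewrite subr_eq0.
apply/eqP; rewrite -(eqrXn2 (_ : 0 < 2)%N)//; last 2 first.
- exact: sqrtr_ge0.
- by rewrite !mulr_ge0 ?invr_ge0// ltW.
apply/eqP; rewrite !exprMn exprVn real_normK ?num_real// dist_charge_sqr /F.
have -> : N y ^+ 2 = (y - x) ^+ 2 + 2 * (x - a) * (y - x) + N x ^+ 2.
  by rewrite !dist_charge_sqr; ring.
have hx : (x - a) ^+ 2 = N x ^+ 2 - b ^+ 2 by rewrite dist_charge_sqr addrK.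
have -> : (x + N x ^+ 2 / (y - x) - a) ^+ 2 =
  (x - a) ^+ 2 + 2 * (x - a) * (N x ^+ 2 / (y - x)) + (N x ^+ 2 / (y - x)) ^+ 2.
  by ring.
by rewrite hx; field.
Qed.

(** The exponent s - 2 of the density is the one for which |y - x| disappears: the kernel
    contributes the power s, the density 2 - s and the derivative -2. *)
Let G_F y : y != x -> G (F y) * (- dF y) = N x `^ (- s) * N y `^ (s - 2).
Proof.
move=> yx; have yx0 : 0 < `|y - x| by rewrite normr_gt0 subr_eq0.
rewrite /G dist_F// /dF opprK.
have -> : `|x - F y| = N x * N x / `|y - x|.
  rewrite /F opprD addNKr normrN normrM normfV [X in X / _]ger0_norm ?sqr_ge0//.
have -> : (y - x) ^+ 2 = `|y - x| ^+ 2 by rewrite real_normK ?num_real.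
set u := `|y - x| in yx0 *.
rewrite !powRM ?invr_ge0 ?mulr_ge0 ?(ltW yx0)// ?ltW//.
have uV p : u^-1 `^ p = (u `^ p)^-1.
  by rewrite -(@powR_inv1 _ u) ?(ltW yx0)// -powRrM mulN1r powRN.
have NE : N x `^ (s - 2) = N x `^ s / N x / N x.
  by rewrite (_ : s - 2 = s - 1 - 1) ?powRB1//; ring.
have uE : u `^ (s - 2) = u `^ s / u / u.
  by rewrite (_ : s - 2 = s - 1 - 1) ?powRB1//; ring.
rewrite !uV NE uE !powRN; field.
by rewrite !gt_eqF ?powR_gt0.
Qed.

Let is_derive_F y : y != x -> is_derive y 1 F (dF y).
Proof.
move=> yx; have yx0 : y - x != 0 by rewrite subr_eq0.
have h : is_derive y 1 (fun y => y - x) 1.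
  by apply: is_derive_eq; rewrite oppr0 addr0.
have hV : is_derive y 1 (fun y : R => (y - x)^-1) (- (y - x) ^- 2).
  split; first exact: derivableV.
  by rewrite deriveV// derive_val scaler1.
have hF := is_deriveD (is_derive_cst x y 1)
  (is_deriveM (is_derive_cst (N x ^+ 2) y 1) hV).
apply: (is_derive_eq hF).
by rewrite scaler0 addr0 add0r /dF /= /GRing.scale/= mulrN.
Qed.

Let derive_F y : y != x -> \forall z \near y, dF z = F^`()%classic z.
Proof.
move=> yx; near=> z; have zx : z != x.
  by near: z; apply: (open_nbhs_nbhs (conj (@open_neq R x) _)).
by have [_ h] := is_derive_F zx; rewrite derive1E h.
Unshelve. all: by end_near. Qed.

Let continuous_dF y : y != x -> {for y, continuous dF}.
Proof.
move=> yx; have yx0 : y - x != 0 by rewrite subr_eq0.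
apply: cvgN; apply: cvgM; first exact: cvg_cst.
apply: cvgV; first by rewrite expf_neq0.
apply: (@continuous_comp _ _ _ (fun y : R => y - x) (fun y => y ^+ 2)).
  by apply: cvgB => //; exact: cvg_cst.
exact: sqr_continuous.
Qed.

Let continuous_F' y : y != x -> {for y, continuous F^`()%classic}.
Proof.
move=> yx; have := continuous_dF yx.
rewrite /prop_for /continuous_at -(nbhs_singleton (derive_F yx)).
by apply: cvg_trans; apply: near_eq_cvg; exact: derive_F.
Qed.

Let continuous_G y : y != x -> {for y, continuous G}.
Proof.
move=> yx; apply: cvgM; last exact: continuous_dist_charge_powR.
apply: (@continuous_comp _ _ _ (fun y : R => `|x - y|) (@powR R ^~ (- s))).
  apply: (@continuous_comp _ _ _ (fun y : R => x - y) (fun y => `|y|)).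
    by apply: cvgB => //; exact: cvg_cst.
  exact: norm_continuous.
by apply: continuous_powR; rewrite normr_gt0 subr_eq0 eq_sym.
Qed.

(** [F] is decreasing on each side of its pole [x], hence the intervals avoiding [x] and the
    exchanged endpoints. *)
Lemma inversion_integral_itv (u v : R) : u < v -> ~~ (u <= x <= v) ->
  (\int[lebesgue_measure]_(y in `[F v, F u]) (G y)%:E =
   \int[lebesgue_measure]_(y in `[u, v]) (N x `^ (- s) * N y `^ (s - 2))%:E)%E.
Proof.
move=> uv xuv.
have uvx y : y \in `[u, v] -> y != x.
  by rewrite in_itv/=; move=> yuv; apply: contraNneq xuv => <-.
have sg y z : y \in `[u, v] -> z \in `[u, v] -> 0 < (y - x) * (z - x).
  rewrite !in_itv/= => /andP[uy yv] /andP[uz zv]; move: xuv.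
  rewrite negb_and -!ltNge => /orP[xu|vx].
    by rewrite mulr_gt0 // subr_gt0; lra.
  by rewrite nmulr_rgt0 subr_lt0; lra.
have uvoo y : y \in `]u, v[ -> y \in `[u, v] by exact: subset_itv_oo_cc.
have uu : u \in `[u, v] by rewrite in_itv/= lexx ltW.
have vv : v \in `[u, v] by rewrite in_itv/= lexx ltW.
have cF y : y \in `[u, v] -> {for y, continuous F}.
  move=> /uvx yx; apply: differentiable_continuous; apply/derivable1_diffP.
  by have [] := is_derive_F yx.
have Fx y : y \in `[u, v] -> (F y - x) * (y - x) = N x ^+ 2.
  by move=> /uvx yx; rewrite /F addrC addKr divfK// subr_eq0.
rewrite integration_by_substitution_decreasing ?ltW//.
- apply: eq_integral => y; rewrite inE => yuv; congr EFin.
  have yx := uvx _ yuv.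
  transitivity (G (F y) * - F^`()%classic y) => //.
  by rewrite -(nbhs_singleton (derive_F yx)) G_F.
- move=> y z yuv zuv zy.
  rewrite /F ltrD2l ltr_pM2l ?exprn_gt0//.
  have hs := sg _ _ yuv zuv.
  have hy : y - x != 0 by rewrite subr_eq0; exact: uvx.
  have hz : z - x != 0 by rewrite subr_eq0; exact: uvx.
  rewrite -subr_gt0.
  have -> : (z - x)^-1 - (y - x)^-1 = (y - z) / ((y - x) * (z - x)).
    by field; rewrite hz hy.
  by rewrite divr_gt0// subr_gt0.
- by move=> y /uvoo/uvx; exact: continuous_F'.
- apply/cvg_ex; exists (F^`()%classic u); apply: cvg_at_right_filter.
  exact/continuous_F'/uvx.
- apply/cvg_ex; exists (F^`()%classic v); apply: cvg_at_left_filter.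
  exact/continuous_F'/uvx.
- split.
  + by move=> y /uvoo/uvx yx; have [] := is_derive_F yx.
  + exact/cvg_at_right_filter/cF.
  + exact/cvg_at_left_filter/cF.
- apply: continuous_in_subspaceT => y; rewrite inE/= in_itv/= => /andP[h1 h2].
  (* The singularity [x] of [G] is outside the image interval, since F u - x and F v - x have the
     same sign. *)
  apply: continuous_G; apply: contraTneq uv => yx; rewrite -leNgt.
  have := Fx _ uu; have := Fx _ vv; have := sg _ _ uu vv.
  rewrite yx in h1 h2 => h3 h4 h5.
  have N0 : 0 < N x ^+ 2 by rewrite exprn_gt0.
  nra.
Qed.

Hypothesis s_gt0 : 0 < s.

(** An exhaustion of the line minus [x] by sets invariant under the inversion, which exchanges the
    distances N x * k and N x / k to the centre. On such a set the change of variables does not move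
    the domain. The shift [i.+2] keeps k > 1, so that the intervals are nondegenerate. *)
Let A (i : nat) : set R :=
  `[x - N x * i.+2%:R, x - N x / i.+2%:R] `|` `[x + N x / i.+2%:R, x + N x * i.+2%:R].

Let A_bigcup : \bigcup_i A i = [set: R] `\ x.
Proof.
apply/seteqP; split => y /=.
  have nx := dist_charge_gt0 x.
  move=> [i _]; have h : 0 < N x / i.+2%:R by rewrite divr_gt0.
  rewrite /A/= !in_itv/= => -[/andP[_ h1]|/andP[h1 _]]; split => // yx;
    move: h h1; rewrite yx; set c := N x / _; lra.
move=> [_ /eqP yx]; have yx0 : 0 < `|y - x| by rewrite normr_gt0 subr_eq0.
have nx := dist_charge_gt0 x.
pose m1 := Num.bound (N x / `|y - x|); pose m2 := Num.bound (`|y - x| / N x).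
pose k := (m1 + m2)%N.
have k1 : N x <= `|y - x| * k.+2%:R.
  rewrite mulrC -ler_pdivrMr//.
  have /ltW/le_trans -> // : N x / `|y - x| < m1%:R.
    by rewrite archi_boundP// divr_ge0// ltW.
  by rewrite ler_nat /k -addn2 -addnA leq_addr.
have k2 : `|y - x| <= N x * k.+2%:R.
  rewrite mulrC -ler_pdivrMr//.
  have /ltW/le_trans -> // : `|y - x| / N x < m2%:R.
    by rewrite archi_boundP// divr_ge0// ltW.
  by rewrite ler_nat /k -addn2 addnAC leq_addl.
have k3 : N x / k.+2%:R <= `|y - x| by rewrite ler_pdivrMr.
exists k => //; rewrite /A/= !in_itv/=.
move: k2 k3; set c := N x / _; set d := N x * _ => k2 k3.
have [xy|xy] := leP x y.
  by right; move: k2 k3; rewrite ger0_norm ?subr_ge0//; lra.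
by left; move: k2 k3; rewrite ltr0_norm ?subr_lt0//; lra.
Qed.

Let measurable_A i : measurable (A i).
Proof. by apply: measurableU; exact: measurable_itv. Qed.

Let nondecreasing_A : nondecreasing_seq A.
Proof.
have nx := dist_charge_gt0 x.
move=> i j ij; apply/subsetPset => y.
have h1 : N x / j.+2%:R <= N x / i.+2%:R.
  by rewrite ler_pM2l// lef_pV2 ?posrE// ler_nat.
have h2 : N x * i.+2%:R <= N x * j.+2%:R by rewrite ler_pM2l// ler_nat.
rewrite /A/= !in_itv/=; move: h1 h2.
set c1 := _ / j.+2%:R; set c2 := _ / _; set d1 := _ * i.+2%:R; set d2 := _ * _;
  move=> h1 h2 -[|] /andP[h3 h4]; [left|right]; lra.
Qed.

Let measurable_G : measurable_fun setT G.
Proof.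
apply: measurable_funM.
  apply: (@measurableT_comp _ _ _ _ _ _ (@powR R ^~ (- s))) => //.
  apply: (@measurableT_comp _ _ _ _ _ _ (fun u : R => `|u|)) => //.
  exact: measurable_funB.
exact: measurable_dist_charge_powR.
Qed.

Let shell (u v : R) : set R := `[x - v, x - u] `|` `[x + u, x + v].

Let integral_shell_setU u v (f : R -> R) : 0 < u ->
  measurable_fun setT f -> (forall y, 0 <= f y) ->
  (\int[lebesgue_measure]_(y in shell u v) (f y)%:E =
   \int[lebesgue_measure]_(y in `[(x - v)%R, (x - u)%R]) (f y)%:E +
   \int[lebesgue_measure]_(y in `[(x + u)%R, (x + v)%R]) (f y)%:E)%E.
Proof.
move=> u0 mf f0; apply: ge0_integral_setU.
- exact: measurable_itv.
- exact: measurable_itv.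
- by apply: measurable_funTS; exact/measurable_EFinP.
- by move=> y _; rewrite lee_fin.
- apply/disj_setPS => y; rewrite /= !in_itv/= => -[/andP[_ h1] /andP[h2 _]].
  lra.
Qed.

(** Under u * v = N x ^ 2 the inversion maps each half of the shell to itself and swaps its
    endpoints. *)
Let integral_shell u v : 0 < u -> u < v -> u * v = N x ^+ 2 ->
  (\int[lebesgue_measure]_(y in shell u v) (G y)%:E =
   \int[lebesgue_measure]_(y in shell u v) (N x `^ (- s) * N y `^ (s - 2))%:E)%E.
Proof.
move=> u0 uv uvE; have v0 := lt_trans u0 uv.
have F1 : F (x + u) = x + v.
  by rewrite /F (addrC x u) addrK -uvE mulrC mulKf ?gt_eqF// addrC.
have F2 : F (x + v) = x + u.
  by rewrite /F (addrC x v) addrK -uvE mulfK ?gt_eqF// addrC.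
have F3 : F (x - u) = x - v.
  by rewrite /F (addrC x (- u)) addrK -uvE invrN mulrN (mulrC u) mulfK ?gt_eqF// addrC.
have F4 : F (x - v) = x - u.
  by rewrite /F (addrC x (- v)) addrK -uvE invrN mulrN mulfK ?gt_eqF// addrC.
have mN : measurable_fun setT (fun y => N x `^ (- s) * N y `^ (s - 2)).
  by apply: measurable_funM => //; exact: measurable_dist_charge_powR.
have N0 y : 0 <= N x `^ (- s) * N y `^ (s - 2) by rewrite mulr_ge0 ?powR_ge0.
have G0 y : 0 <= G y by rewrite mulr_ge0 ?powR_ge0.
have e1 := @inversion_integral_itv (x - v) (x - u).
have e2 := @inversion_integral_itv (x + u) (x + v).
rewrite F1 F2 in e2; rewrite F3 F4 in e1.
apply: (etrans (integral_shell_setU v u0 measurable_G G0)).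
apply: (etrans _ (esym (integral_shell_setU v u0 mN N0))).
apply: (f_equal2 (fun c d => (c + d)%E)).
  apply: e1; first by rewrite ltrD2l ltrN2.
  by apply/negP; lra.
apply: e2; first by rewrite ltrD2l.
by apply/negP; lra.
Qed.

Let integral_A i :
  (\int[lebesgue_measure]_(y in A i) (G y)%:E =
   \int[lebesgue_measure]_(y in A i) (N x `^ (- s) * N y `^ (s - 2))%:E)%E.
Proof.
have nx := dist_charge_gt0 x.
have k1 : 1 < i.+2%:R :> R by rewrite ltr1n.
have k0 : (0 < i.+2%:R :> R) by [].
apply: integral_shell; first by rewrite divr_gt0.
  by rewrite ltr_pM2l// (lt_trans _ k1)// invf_lt1.
by rewrite mulrACA mulVf ?gt_eqF// mulr1 expr2.
Qed.

Lemma integral_riesz_density :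
  (\int[@leb R]_y (riesz_kernel s x y * (N y `^ (s - 2))%:E) =
   (N x `^ (- s))%:E * \int[@leb R]_y (N y `^ (s - 2))%:E)%E.
Proof.
have hN : measurable_fun setT (fun y => N y `^ (s - 2)).
  exact: measurable_dist_charge_powR.
have mk := measurable_riesz_kernel1 s x.
have mf : measurable_fun setT (fun y => riesz_kernel s x y * (N y `^ (s - 2))%:E)%E.
  by apply: emeasurable_funM => //; exact/measurable_EFinP.
have f0 y : (0 <= riesz_kernel s x y * (N y `^ (s - 2))%:E)%E.
  rewrite mule_ge0 ?lee_fin ?powR_ge0// /riesz_kernel.
  by case: ifP => // _; rewrite lee_fin powR_ge0.
have mx : measurable ([set: R] `\ x) by exact: measurableD.
rewrite -ge0_integralZl//; last 3 first.
- exact/measurable_EFinP.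
- by move=> y _; rewrite lee_fin powR_ge0.
- by rewrite lee_fin powR_ge0.
rewrite !ge0_integral_leb//; last 2 first.
- by apply: measurable_funeM; exact/measurable_EFinP.
- by move=> y _; rewrite -EFinM lee_fin mulr_ge0 ?powR_ge0.
rewrite -!(@integral_setD1 _ _ x setT)//; last 2 first.
- apply: measurable_funTS; apply: measurable_funeM; exact/measurable_EFinP.
- exact: measurable_funTS.
transitivity (\int[lebesgue_measure]_(y in [set: R] `\ x) (G y)%:E)%E.
  apply: eq_integral => y; rewrite inE => -[_ /= /eqP yx].
  by rewrite /riesz_kernel eq_sym (negbTE yx).
rewrite -A_bigcup.
have h1 : (\int[lebesgue_measure]_(y in A i) (G y)%:E @[i --> \oo] -->
  \int[lebesgue_measure]_(y in \bigcup_i A i) (G y)%:E)%E.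
  apply: ge0_nondecreasing_set_cvg_integral => //.
  - by move=> i; apply: measurable_funTS; exact/measurable_EFinP.
  - by move=> i y _; rewrite lee_fin mulr_ge0 ?powR_ge0.
have h2 : (\int[lebesgue_measure]_(y in A i) (N x `^ (- s) * N y `^ (s - 2))%:E
  @[i --> \oo] -->
  \int[lebesgue_measure]_(y in \bigcup_i A i) (N x `^ (- s) * N y `^ (s - 2))%:E)%E.
  apply: ge0_nondecreasing_set_cvg_integral => //.
  - move=> i; apply: measurable_funTS; apply/measurable_EFinP.
    by apply: measurable_funM.
  - by move=> i y _; rewrite lee_fin mulr_ge0 ?powR_ge0.
rewrite (eq_cvg _ _ integral_A) in h1.
have := cvg_unique _ h1 h2; apply; exact: ereal_hausdorff.
Qed.

End inversion.
End point_charge.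

(** * Measures packaged by their mass or given by a density *)

Section pack_measures.
Context d (T : measurableType d) (R : realType).
Variable m : {measure set T -> \bar R}.

(** The bound on the mass is an argument, so that the richer structure is attached to this name
    while the set function stays convertible to [m]. *)
Definition as_finite of (m setT < +oo)%E : set T -> \bar R := m.
Definition as_probability of m setT = 1%E : set T -> \bar R := m.

Section instances.
Hypotheses (moo : (m setT < +oo)%E) (m1 : m setT = 1%E).

HB.instance Definition _ := Measure.copy (as_finite moo) m.
HB.instance Definition _ :=
  Measure_isFinite.Build _ _ _ (as_finite moo) (lty_fin_num_fun moo).

HB.instance Definition _ := Measure.copy (as_probability m1) m.
HB.instance Definition _ :=
  Measure_isProbability.Build _ _ _ (as_probability m1) m1.
End instances.

Lemma probability_of_measure : m setT = 1%E ->
  exists P : probability T R, (P : set T -> \bar R) = m.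
Proof. by move=> m1; exists (as_probability m1). Qed.

End pack_measures.

Section density_measure.
Local Open Scope ereal_scope.
Context d (T : measurableType d) (R : realType).
Variables (mu : {measure set T -> \bar R}) (h : T -> R).
Hypotheses (h_ge0 : forall x, (0 <= h x)%R) (mh : measurable_fun setT h).

(* the hypotheses are arguments so that the measure structure is inferred
   without side conditions *)
Definition density (h_ge0 : forall x, (0 <= h x)%R) (mh : measurable_fun setT h)
  (A : set T) : \bar R := \int[mu]_(x in A) (h x)%:E.

Local Notation nu := (density h_ge0 mh).

Let nu0 : nu set0 = 0.
Proof. exact: integral_set0. Qed.

Let nu_ge0 A : 0 <= nu A.
Proof. by apply: integral_ge0 => x _; rewrite lee_fin. Qed.

Let nu_sigma_additive : semi_sigma_additive nu.
Proof.
move=> F mF tF mUF; rewrite /density ge0_integral_bigcup//.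
- apply: is_cvg_ereal_nneg_natsum_cond => n _ _.
  by apply: integral_ge0 => x _; rewrite lee_fin.
- by apply: measurable_funTS; exact/measurable_EFinP.
- by move=> x _; rewrite lee_fin.
Qed.

HB.instance Definition _ :=
  isMeasure.Build _ _ _ nu nu0 nu_ge0 nu_sigma_additive.

Import HBNNSimple.

Lemma ge0_integral_density (f : T -> \bar R) :
  measurable_fun setT f -> (forall x, 0 <= f x) ->
  \int[nu]_x f x = \int[mu]_x (f x * (h x)%:E).
Proof.
move=> mf f0; pose g := nnsfun_approx measurableT mf.
have mhE : measurable_fun setT (fun x => (h x)%:E) by exact/measurable_EFinP.
have mgE n : measurable_fun setT (fun x => (g n x)%:E).
  exact/measurable_EFinP/measurable_funP.
have gf x : (g n x)%:E @[n --> \oo] --> f x by exact: cvg_nnsfun_approx.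
have gnd x : {homo (fun n => (g n x)%:E) : m n / (m <= n)%N >-> m <= n}.
  by move=> m n mn; rewrite lee_fin; exact/lefP/nd_nnsfun_approx.
have -> : \int[nu]_x f x = limn (fun n => \int[nu]_x (g n x)%:E).
  under eq_integral do rewrite -(cvg_lim _ (gf _))//.
  by apply: monotone_convergence => // n x _; rewrite lee_fin.
have -> : \int[mu]_x (f x * (h x)%:E) = limn (fun n => \int[mu]_x ((g n x)%:E * (h x)%:E)).
  have gfh x : ((g n x)%:E * (h x)%:E)%E @[n --> \oo] --> f x * (h x)%:E by exact: cvgeZr.
  under eq_integral do rewrite -(cvg_lim _ (gfh _))//.
  apply: monotone_convergence => //.
  - by move=> n; exact: emeasurable_funM.
  - by move=> n x _; rewrite mule_ge0 ?lee_fin.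
  - by move=> x _ m n mn; rewrite lee_wpmul2r ?lee_fin// -lee_fin; exact: gnd.
congr (limn _); apply/funext => n.
have gE x : (g n x)%:E = \sum_(y \in range (g n)) (y * \1_(g n @^-1` [set y]) x)%:E.
  by rewrite {1}fimfunE -fsumEFin.
have m1 y : measurable_fun setT (fun x => (y * \1_(g n @^-1` [set y]) x)%:E).
  by apply/measurable_EFinP; exact: measurable_funM.
have m2 y : measurable_fun setT (fun x => (y * \1_(g n @^-1` [set y]) x)%:E * (h x)%:E).
  exact: emeasurable_funM.
transitivity (\int[nu]_x (\sum_(y \in range (g n))
    (y * \1_(g n @^-1` [set y]) x)%:E)).
  by apply: eq_integral => x _; exact: gE.
rewrite ge0_integral_fsum//; last by move=> y x _; exact: nnfun_muleindic_ge0.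
transitivity (\int[mu]_x (\sum_(y \in range (g n))
    (y * \1_(g n @^-1` [set y]) x)%:E * (h x)%:E)); last first.
  apply: eq_integral => x _; rewrite gE ge0_mule_fsuml// => y.
  exact: nnfun_muleindic_ge0.
rewrite ge0_integral_fsum//; last first.
  by move=> y x _; rewrite mule_ge0 ?lee_fin// -lee_fin; exact: nnfun_muleindic_ge0.
apply: eq_fsbigr => y; rewrite inE => -[z _ <-].
under eq_integral do rewrite EFinM.
rewrite integralZl_indic_nnsfun// integral_indic// setIT.
under [RHS]eq_integral do rewrite EFinM -muleA.
rewrite ge0_integralZl ?lee_fin//.
- congr (_ * _); transitivity (\int[mu]_(x in g n @^-1` [set g n z]) (h x)%:E) => //.
  rewrite integral_mkcond; apply: eq_integral => x _.
  by rewrite epatch_indic muleC.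
- by apply: emeasurable_funM => //; exact/measurable_EFinP.
- by move=> x _; rewrite mule_ge0 ?lee_fin.
Qed.

End density_measure.

Section integral_gt0.
Local Open Scope ereal_scope.
Context d (T : measurableType d) (R : realType).
Variables (mu : {measure set T -> \bar R}).

(** A zero integral would make [f] vanish almost everywhere on [A], which has positive measure. *)
Lemma ge0_integral_gt0 (A : set T) (f : T -> \bar R) : measurable A ->
  measurable_fun A f -> (forall x, A x -> 0 < f x) -> 0 < mu A ->
  0 < \int[mu]_(x in A) f x.
Proof.
move=> mA mf f0 muA; rewrite lt0e integral_ge0 ?andbT; last by move=> x /f0/ltW.
apply/eqP => If; have : \int[mu]_(x in A) `|f x| = 0.
  by rewrite -[RHS]If; apply: eq_integral => x; rewrite inE => /f0/ltW/gee0_abs.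
move/(ae_eq_integral_abs mu mA mf) => [N [mN N0 AN]].
have : mu A <= mu N.
  apply: le_measure; rewrite ?inE// => x Ax; apply: AN => /=.
  by move=> /(_ Ax) fx0; have := f0 _ Ax; rewrite fx0 ltxx.
by rewrite N0 leNgt muA.
Qed.

End integral_gt0.

(** * Square-integrable functions and their scalar product *)

Section square_integrable.
Context d (T : measurableType d) (R : realType).
Variables (mu : {measure set T -> \bar R}).
Implicit Types (f g h : T -> R) (c : R).

Definition L2 f := measurable_fun setT f /\
  (\int[mu]_x (f x ^+ 2)%:E < +oo)%E.

(** Real-valued, so that expansions of energies become polynomial identities. The product of two
    [L2] functions is integrable by [L2_integrable], which gives the value its meaning. *)
Definition L2ip f g : R := \int[mu]_x (f x * g x).

Lemma L2_integrable f g : L2 f -> L2 g ->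
  mu.-integrable setT (fun x => (f x * g x)%:E).
Proof.
move=> [mf If] [mg Ig].
have mX (k : T -> R) : measurable_fun setT k -> measurable_fun setT (fun x => (k x ^+ 2)%:E).
  by move=> mk; apply/measurable_EFinP; exact: measurable_funX.
apply: (@le_integrable _ _ _ _ _ _ _ (fun x => (f x ^+ 2)%:E + (g x ^+ 2)%:E)%E) => //.
- by apply/measurable_EFinP; exact: measurable_funM.
- move=> x _; rewrite -EFinD !abse_EFin lee_fin [leRHS]ger0_norm ?addr_ge0 ?sqr_ge0//.
  rewrite ler_norml; have := sqr_ge0 (f x - g x); have := sqr_ge0 (f x + g x).
  have := sqr_ge0 (f x); have := sqr_ge0 (g x); nra.
- have iX (k : T -> R) : measurable_fun setT k -> (\int[mu]_x (k x ^+ 2)%:E < +oo)%E ->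
      mu.-integrable setT (fun x => (k x ^+ 2)%:E).
    move=> mk Ik; apply/integrableP; split; first exact: mX.
    by under eq_integral do rewrite gee0_abs ?lee_fin ?sqr_ge0//.
  by apply: integrableD => //; exact: iX.
Qed.

Lemma L2D f g : L2 f -> L2 g -> L2 (fun x => f x + g x).
Proof.
move=> Lf Lg; have [mf If] := Lf; have [mg Ig] := Lg.
split; first exact: measurable_funD.
have /integrableP[_] : mu.-integrable setT
    (fun x => (f x * f x)%:E + (f x * g x)%:E + ((g x * f x)%:E + (g x * g x)%:E))%E.
  by apply: integrableD => //; apply: integrableD => //; exact: L2_integrable.
apply: le_lt_trans; apply: ge0_le_integral => //.
- by move=> x _; rewrite lee_fin sqr_ge0.
- by apply/measurable_EFinP; apply: measurable_funX; exact: measurable_funD.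
- apply: measurableT_comp => //; apply/measurable_EFinP.
  by repeat apply: measurable_funD; exact: measurable_funM.
- by move=> x _; rewrite -!EFinD abse_EFin lee_fin (le_trans _ (ler_norm _))//; lra.
Qed.

Lemma L2Z c f : L2 f -> L2 (fun x => c * f x).
Proof.
move=> [mf If]; split; first exact: measurable_funM.
under eq_integral do rewrite exprMn EFinM.
rewrite ge0_integralZl ?lee_fin ?sqr_ge0//.
- by rewrite lte_mul_pinfty ?lee_fin ?sqr_ge0.
- by apply/measurable_EFinP; exact: measurable_funX.
- by move=> x _; rewrite lee_fin sqr_ge0.
Qed.

Lemma L2B f g : L2 f -> L2 g -> L2 (fun x => f x - g x).
Proof.
move=> Lf /(L2Z (-1)) Lg; have := L2D Lf Lg.
by under eq_fun do rewrite mulN1r.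
Qed.

Lemma L2ipC f g : L2ip f g = L2ip g f.
Proof. by apply: eq_Rintegral => x _; rewrite mulrC. Qed.

Lemma L2ipDl f g h : L2 f -> L2 g -> L2 h ->
  L2ip (fun x => f x + g x) h = L2ip f h + L2ip g h.
Proof.
move=> Lf Lg Lh; rewrite /L2ip -RintegralD//; try exact: L2_integrable.
by apply: eq_Rintegral => x _; rewrite mulrDl.
Qed.

Lemma L2ipZl c f g : L2 f -> L2 g ->
  L2ip (fun x => c * f x) g = c * L2ip f g.
Proof.
move=> Lf Lg; rewrite /L2ip -RintegralZl//; last exact: L2_integrable.
by apply: eq_Rintegral => x _; rewrite mulrA.
Qed.

Lemma L2ipBl f g h : L2 f -> L2 g -> L2 h ->
  L2ip (fun x => f x - g x) h = L2ip f h - L2ip g h.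
Proof.
move=> Lf Lg Lh; rewrite -[- L2ip g h]mulN1r -L2ipZl// -L2ipDl//; last exact: L2Z.
by apply: eq_Rintegral => x _; rewrite mulN1r.
Qed.

Lemma L2ip_ge0 f : 0 <= L2ip f f.
Proof. by apply: Rintegral_ge0 => x _; rewrite -expr2 sqr_ge0. Qed.

Lemma L2ipE f : L2 f -> (L2ip f f)%:E = (\int[mu]_x (f x ^+ 2)%:E)%E.
Proof.
move=> Lf; rewrite /L2ip /Rintegral fineK//.
exact: integrable_fin_num (L2_integrable Lf Lf).
Qed.

Lemma ge0_L2ipE f g : L2 f -> L2 g ->
  (L2ip f g)%:E = (\int[mu]_x (f x * g x)%:E)%E.
Proof.
move=> Lf Lg; rewrite /L2ip /Rintegral fineK//.
exact: integrable_fin_num (L2_integrable Lf Lg).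
Qed.

Lemma L2ip_eq0 f : L2 f -> L2ip f f <= 0 -> {ae mu, forall x, f x = 0}.
Proof.
move=> Lf f0; have [mf _] := Lf.
have : (\int[mu]_x `|(f x ^+ 2)%:E| = 0)%E.
  under eq_integral do rewrite gee0_abs ?lee_fin ?sqr_ge0//.
  by rewrite -L2ipE//; congr EFin; apply/eqP; rewrite eq_le f0 L2ip_ge0.
move/(ae_eq_integral_abs mu measurableT); case.
  by apply/measurable_EFinP; exact: measurable_funX.
move=> N [mN N0 sN]; exists N; split => // x /= fx; apply: sN => /= /(_ Logic.I).
by move=> [/eqP]; rewrite sqrf_eq0 => /eqP.
Qed.

End square_integrable.

(** * The probability [sigma] swept from the charge *)

Section charge_balayage.
Variables (R : realType) (s : R).
Hypotheses (s_gt0 : 0 < s) (s_lt1 : s < 1).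
Local Notation leb := (@leb R).
Local Notation N := (@dist_charge R).

Lemma le0_powR (p x y : R) : p <= 0 -> 0 < x -> x <= y -> y `^ p <= x `^ p.
Proof.
move=> p0 x0 xy; have y0 : 0 < y := lt_le_trans x0 xy.
rewrite -[p]opprK ![_ `^ (- - p)]powRN lef_pV2 ?posrE ?powR_gt0//.
by apply: ge0_ler_powR; rewrite ?nnegrE ?oppr_ge0// ltW.
Qed.

Let s2_le0 : s - 2 <= 0.
Proof. by move: s_lt1; lra. Qed.

Let meas_dens a b : b != 0 -> measurable_fun setT (fun y => (N a b y `^ (s - 2))%:E).
Proof. by move=> b0; apply/measurable_EFinP; exact: measurable_dist_charge_powR. Qed.

(** The density is at most (y - a)^(s - 2) there, and s < 1 puts this exponent below -1. *)
Let density_tail (a b : R) : b != 0 ->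
  (\int[lebesgue_measure]_(y in `[(a + 1)%R, +oo[) (N a b y `^ (s - 2))%:E < +oo)%E.
Proof.
move=> b0.
pose F (y : R) : R := (s - 1)^-1 * (y - a) `^ (s - 1).
have s10 : s - 1 != 0 by rewrite lt_eqF// subr_lt0.
have dF (x : R) : a < x -> is_derive x 1 F ((x - a) `^ (s - 2)).
  move=> ax; have xa0 : 0 < x - a by rewrite subr_gt0.
  have h1 : is_derive x 1 (fun y : R => y - a) 1.
    by apply: is_derive_eq; rewrite oppr0 addr0.
  have h2 := @is_derive1_powR _ (s - 1) (x - a) xa0.
  have h3 := @is_derive1_comp _ (@powR R ^~ (s - 1)) (fun y : R => y - a) x _ _ h2 h1.
  have h4 := is_deriveM (is_derive_cst (s - 1)^-1 x 1) h3.
  apply: (is_derive_eq h4).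
  rewrite scaler0 addr0 /= /GRing.scale/= mulr1 mulrA mulVf// mul1r.
  by congr (_ `^ _); ring.
have cF x : a < x -> {for x, continuous F}.
  move=> ax; apply: differentiable_continuous; apply/derivable1_diffP.
  by have [] := dF _ ax.
have aa1 x : a + 1 <= x -> a < x by move=> h; lra.
have cP p x : a < x -> {for x, continuous (fun y : R => (y - a) `^ p)}.
  move=> ax; apply: (@continuous_comp _ _ _ (fun y : R => y - a) (@powR R ^~ p)).
    by apply: cvgB => //; exact: cvg_cst.
  by apply: continuous_powR; rewrite subr_gt0.
have I : (\int[lebesgue_measure]_(y in `[(a + 1)%R, +oo[) ((y - a) `^ (s - 2))%:E < +oo)%E.
  rewrite (@ge0_continuous_FTC2y _ _ F (a + 1) 0).
  - by rewrite -EFinB ltry.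
  - by move=> x _; exact: powR_ge0.
  - apply: continuous_in_subspaceT => x; rewrite inE/= in_itv/= andbT => /aa1.
    exact: cP.
  - rewrite -[0](mulr0 (s - 1)^-1); apply: cvgM; first exact: cvg_cst.
    have -> : s - 1 = - (1 - s) by ring.
    apply: (@cvg_comp _ _ _ (fun y : R => y - a) (@powR R ^~ (- (1 - s))) _ (+oo)%R).
      exact: cvg_addrr.
    by apply: cvgy_powRN; rewrite subr_gt0.
  - by move=> x /ltW/aa1 /dF[].
  - by apply/cvg_at_right_filter/cF; rewrite ltrDl.
  - by move=> x; rewrite in_itv/= andbT => /ltW/aa1/dF [_ h]; rewrite derive1E h.
apply: le_lt_trans I; apply: ge0_le_integral => //.
- by move=> x _; rewrite lee_fin powR_ge0.
- by apply: measurable_funTS; exact: meas_dens.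
- apply: measurable_funTS; apply/measurable_EFinP.
  apply: (@measurableT_comp _ _ _ _ _ _ (@powR R ^~ (s - 2))) => //.
  exact: measurable_funB.
- move=> x; rewrite /= in_itv/= andbT => /aa1 ax; rewrite lee_fin.
  apply: le0_powR => //; first by rewrite subr_gt0.
  exact: le_trans (ler_norm _) (dist_charge_sub _ _ _).
Qed.

Let density_fin (a b : R) : b != 0 ->
  (\int[leb]_y (N a b y `^ (s - 2))%:E < +oo)%E.
Proof.
move=> b0; have mD := meas_dens a b0.
have D0 y : (0 <= (N a b y `^ (s - 2))%:E)%E by rewrite lee_fin powR_ge0.
have -> : [set: R] = `]-oo, a - 1] `|` (`]a - 1, a + 1[ `|` `[a + 1, +oo[).
  apply/seteqP; split => // y _ /=; rewrite !in_itv/= andbT.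
  have [|h1] := leP y (a - 1); first by left.
  by right; have [|h2] := leP (a + 1) y; [right|left].
have m1 : measurable (`]-oo, (a - 1)%R]%classic : set R) by exact: measurable_itv.
have m2 : measurable (`](a - 1)%R, (a + 1)%R[%classic : set R) by exact: measurable_itv.
have m3 : measurable (`[(a + 1)%R, +oo[%classic : set R) by exact: measurable_itv.
have d1 : [disjoint (`]-oo, (a - 1)%R]%classic : set R) &
    `](a - 1)%R, (a + 1)%R[%classic `|` `[(a + 1)%R, +oo[%classic].
  by apply/disj_setPS => y; rewrite /= !in_itv/= andbT => -[h1 [/andP[h2 _]|h2]]; lra.
have d2 : [disjoint (`](a - 1)%R, (a + 1)%R[%classic : set R) & `[(a + 1)%R, +oo[%classic].
  by apply/disj_setPS => y; rewrite /= !in_itv/= andbT => -[/andP[_ h1] h2]; lra.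
rewrite (ge0_integral_setU _ m1 (measurableU _ _ m2 m3) (measurable_funTS mD) _ d1)//.
rewrite (ge0_integral_setU _ m2 m3 (measurable_funTS mD) _ d2)//.
have h1 : (\int[leb]_(y in `[(a + 1)%R, +oo[) (N a b y `^ (s - 2))%:E < +oo)%E.
  by rewrite ge0_integral_leb//; [exact: density_tail|exact: measurable_funTS].
have h2 : (\int[leb]_(y in `](a - 1)%R, (a + 1)%R[) (N a b y `^ (s - 2))%:E < +oo)%E.
  apply: (@le_lt_trans _ _ (\int[leb]_(x in `](a - 1)%R, (a + 1)%R[)
     (cst (`|b| `^ (s - 2))%:E) x)%E).
    apply: ge0_le_integral => //; first exact: measurable_funTS.
    move=> x _; rewrite lee_fin; apply: le0_powR => //; first by rewrite normr_gt0.
    exact: dist_charge_ge.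
  rewrite integral_cst//= [X in (_ * X)%E](@leb_itvoo R (a - 1) (a + 1)) -?EFinM ?ltry//.
  lra.
have h3 : (\int[leb]_(y in `]-oo, (a - 1)%R]) (N a b y `^ (s - 2))%:E < +oo)%E.
  rewrite ge0_integral_leb//; last exact: measurable_funTS.
  (* The reflection y -> - y turns the left tail into a right tail for the charge placed over -
     a. *)
  have -> : (a - 1 = - (1 - a))%R by ring.
  rewrite ge0_integration_by_substitutionNy; last 2 first.
  - apply: continuous_subspaceT; exact: continuous_dist_charge_powR.
  - by move=> x _; exact: powR_ge0.
  rewrite [ltLHS](_ : _ = (\int[lebesgue_measure]_(y in `[(- a + 1)%R, +oo[) (N (- a) b y `^ (s - 2))%:E)%E).
    exact: density_tail.
  rewrite addrC; apply: eq_integral => x _ /=; congr (_ `^ _)%:E; rewrite /dist_charge.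
  by congr Num.sqrt; congr (_ + _); rewrite -sqrrN; congr (_ ^+ 2); ring.
by rewrite lte_add_pinfty// lte_add_pinfty.
Qed.

(** The total integral on the right of [integral_riesz_density] is also the normalizing constant, so
    the potential comes out with coefficient exactly 1. Positivity on open intervals later turns an
    inequality tested on [sigma] into one valid on a dense set. *)
Lemma riesz_balayage (a b : R) : b != 0 -> exists sigma : probability R R,
  (forall x, (\int[sigma]_y riesz_kernel s x y = (N a b x `^ (- s))%:E)%E) /\
  (forall u v : R, u < v -> (0 < sigma `]u, v[%classic)%E).
Proof.
move=> b0; have mD := meas_dens a b0.
have D0 y : (0 <= (N a b y `^ (s - 2))%:E)%E by rewrite lee_fin powR_ge0.
have Npos y : 0 < N a b y `^ (s - 2) by rewrite powR_gt0 ?dist_charge_gt0.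
pose I := (\int[leb]_y (N a b y `^ (s - 2))%:E)%E.
have Ifin : I \is a fin_num by rewrite ge0_fin_numE ?integral_ge0// density_fin.
have I0 : (0 < I)%E.
  apply: ge0_integral_gt0 => //; first by move=> y _; rewrite lte_fin.
  apply: (@lt_le_trans _ _ (leb `]0%R, 1%R[%classic)).
    by rewrite leb_itvoo// subr0 lte_fin.
  by apply: le_measure; rewrite ?inE//; exact: measurable_itv.
pose Z := fine I.
have Z0 : 0 < Z by rewrite fine_gt0// I0 ltey_eq Ifin.
pose h y := Z^-1 * N a b y `^ (s - 2).
have h0 y : 0 <= h y by rewrite mulr_ge0 ?powR_ge0 ?invr_ge0 ?ltW.
have hgt0 y : 0 < h y by rewrite mulr_gt0 ?invr_gt0.
have mh : measurable_fun setT h.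
  by apply: measurable_funM => //; exact/measurable_EFinP.
have nu1 : density leb h0 mh setT = 1%E.
  rewrite /density; under eq_integral do rewrite EFinM.
  rewrite ge0_integralZl ?lee_fin ?invr_ge0 ?(ltW Z0)// -/I -(fineK Ifin).
  by rewrite -EFinM mulVf// gt_eqF.
have [sigma sigmaE] := probability_of_measure nu1.
exists sigma; split.
  move=> x; have mk := measurable_riesz_kernel1 s x.
  have k0 y := riesz_kernel_ge0 s x y.
  rewrite sigmaE ge0_integral_density//.
  under eq_integral do rewrite EFinM muleCA.
  rewrite ge0_integralZl ?lee_fin ?invr_ge0 ?(ltW Z0)//; last 2 first.
  - exact: emeasurable_funM.
  - by move=> y _; exact: mule_ge0.
  rewrite integral_riesz_density// -/I -(fineK Ifin) muleCA -EFinM mulVf ?mule1 ?mulr1//.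
  by rewrite gt_eqF.
move=> u v uv; rewrite sigmaE.
apply: ge0_integral_gt0 => //.
- by apply: measurable_funTS; exact/measurable_EFinP.
- by move=> y _; rewrite lte_fin.
by suff : (0 < leb `]u, v[%classic)%E by []; rewrite leb_itvoo// lte_fin subr_gt0.
Qed.

End charge_balayage.

(** * Energy as a squared L2 norm *)

Section trace.
Variables (R : realType) (s : R).
Hypothesis s_gt0 : 0 < s.
Local Notation leb := (@leb R).
Local Notation leb2 := (@leb2 R).

(** The [nu]-average of the windows: [p.1] is the length of the interval and [p.2] its starting
    point. [fine] loses nothing on finite measures. *)
Definition trace (nu : set R -> \bar R) (p : R * R) : R :=
  window_weight s p.1 * fine (nu `]p.2, (p.2 + p.1)%R]%classic).

Lemma trace_ge0 (nu : {measure set R -> \bar R}) p : 0 <= trace nu p.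
Proof. by rewrite mulr_ge0 ?window_weight_ge0 ?fine_ge0. Qed.

Lemma integral_window_trace (nu : {finite_measure set R -> \bar R}) p :
  (\int[nu]_x (window s x p)%:E = (trace nu p)%:E)%E.
Proof.
rewrite /window; under eq_integral do rewrite EFinM.
have mI : measurable (`]p.2, p.2 + p.1]%classic : set R) by [].
rewrite (eq_integral (fun x : R => ((window_weight s p.1)%:E *
    (\1_(`]p.2, p.2 + p.1]%classic : set R) x)%:E)%E)); last first.
  by move=> x _; rewrite indicE mem_setE in_itv.
rewrite ge0_integralZl ?lee_fin ?window_weight_ge0//; last first.
  by apply/measurable_EFinP.
by rewrite integral_indic// setIT /trace EFinM fineK// fin_num_measure.
Qed.

Lemma measurable_trace (nu : {finite_measure set R -> \bar R}) :
  measurable_fun setT (trace nu).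
Proof.
apply/measurable_EFinP.
rewrite (_ : _ \o _ = fun p => \int[nu]_x (window s x p)%:E)%E; last first.
  by apply/funext => p; rewrite integral_window_trace.
have := @measurable_fun_fubini_tonelli_G _ _ _ _ _ nu
  (fun z : R * (R * R) => (window s z.1 z.2)%:E); apply.
- by apply/measurable_EFinP; exact: measurable_window.
- by move=> z; rewrite lee_fin window_ge0.
Qed.

Lemma mutual_energyE (nu1 nu2 : {finite_measure set R -> \bar R}) :
  (\int[nu1]_x \int[nu2]_y riesz_kernel s x y =
   \int[leb2]_p (trace nu1 p * trace nu2 p)%:E)%E.
Proof.
have step1 x : (\int[nu2]_y riesz_kernel s x y =
    \int[leb2]_p (window s x p * trace nu2 p)%:E)%E.
  under eq_integral do rewrite -integral_window//.
  rewrite (@fubini_tonelli _ _ _ _ _ nu2 leb2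
    (fun z : R * (R * R) => (window s x z.2 * window s z.1 z.2)%:E)); last 2 first.
  - apply/measurable_EFinP; apply: measurable_funM; last exact: measurable_window.
    exact: (measurableT_comp (measurable_window1 s x) measurable_snd).
  - by move=> z; rewrite lee_fin mulr_ge0 ?window_ge0.
  apply: eq_integral => p _ /=; under eq_integral do rewrite EFinM.
  rewrite ge0_integralZl ?lee_fin ?window_ge0//.
  - by rewrite integral_window_trace EFinM.
  - by apply/measurable_EFinP; exact: measurable_window2.
  - by move=> y _; rewrite lee_fin window_ge0.
under eq_integral do rewrite step1.
rewrite (@fubini_tonelli _ _ _ _ _ nu1 leb2
  (fun z : R * (R * R) => (window s z.1 z.2 * trace nu2 z.2)%:E)); last 2 first.
- apply/measurable_EFinP; apply: measurable_funM; first exact: measurable_window.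
  exact: (measurableT_comp (measurable_trace nu2) measurable_snd).
- by move=> z; rewrite lee_fin mulr_ge0 ?window_ge0 ?trace_ge0.
apply: eq_integral => p _ /=; under eq_integral do rewrite EFinM muleC.
rewrite ge0_integralZl ?lee_fin ?trace_ge0//.
- by rewrite integral_window_trace EFinM muleC.
- by apply/measurable_EFinP; exact: measurable_window2.
- by move=> y _; rewrite lee_fin window_ge0.
Qed.

Lemma L2_trace (nu : {finite_measure set R -> \bar R}) :
  L2 leb2 (trace nu) <-> (\int[nu]_x \int[nu]_y riesz_kernel s x y < +oo)%E.
Proof.
rewrite mutual_energyE; under eq_integral do rewrite -expr2.
by split=> [[]//|h]; split => //; exact: measurable_trace.
Qed.

Lemma mutual_energy_L2ip (nu1 nu2 : {finite_measure set R -> \bar R}) :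
  L2 leb2 (trace nu1) -> L2 leb2 (trace nu2) ->
  (\int[nu1]_x \int[nu2]_y riesz_kernel s x y = (L2ip leb2 (trace nu1) (trace nu2))%:E)%E.
Proof. by move=> h1 h2; rewrite mutual_energyE ge0_L2ipE. Qed.

Lemma measure_itv_shrink (nu : {finite_measure set R -> \bar R}) (x : R) :
  fine (nu `]x, x + n.+1%:R^-1]%classic) @[n --> \oo] --> (0 : R).
Proof.
have -> : (0 : R) = fine (nu set0) by rewrite measure0.
have -> : set0 = \bigcap_n `]x, x + n.+1%:R^-1]%classic.
  apply/seteqP; split => // y /= h.
  have xy : 0 < y - x by have := h 0%N Logic.I; rewrite /= in_itv/= subr_gt0 => /andP[].
  have := h (Num.bound (y - x)^-1) Logic.I; rewrite /= in_itv/= => /andP[_].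
  rewrite -lerBlDl leNgt => /negP; apply.
  rewrite invf_plt ?posrE//; apply: lt_le_trans (_ : (Num.bound (y - x)^-1)%:R <= _).
    by rewrite archi_boundP// invr_ge0 ltW.
  by rewrite ler_nat.
apply: fine_cvg; rewrite fineK; last first.
  by rewrite fin_num_measure//; exact: bigcap_measurable.
apply: (@nonincreasing_cvg_mu _ _ _ nu (fun n => `]x, x + n.+1%:R^-1]%classic)) => //.
- by rewrite -ge0_fin_numE// fin_num_measure.
- exact: bigcap_measurable.
- move=> m n mn; apply/subsetPset => y; rewrite /= !in_itv/= => /andP[-> h]/=.
  by rewrite (le_trans h)// lerD2l lef_pV2 ?posrE// ler_nat.
Qed.

(** The identity is known only for almost every window, so the two endpoints are pushed slightly to
    the right until a good window is met. The error is controlled by the masses of ]t, t + e] and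
    ]u, u + e], which vanish with e because these intervals shrink to the empty set. *)
Lemma trace_inj (nu1 nu2 : {finite_measure set R -> \bar R}) (c : R) :
  {ae leb2, forall p, trace nu1 p = c * trace nu2 p} ->
  forall t u, t < u -> fine (nu1 `]t, u]%classic) = c * fine (nu2 `]t, u]%classic).
Proof.
move=> [N [mN N0 sN]] t u tu.
have good (e : R) : 0 < e -> exists t' u', [/\ t < t' <= t + e, u < u' <= u + e, t' < u' &
    fine (nu1 `]t', u']%classic) = c * fine (nu2 `]t', u']%classic)].
  (* Half of [e] for the start and half for the length: the right end is their sum. The box [B] of
     such windows has positive area, so it is not contained in the null set [N]. *)
  move=> e0; pose e2 := e / 2; have e20 : 0 < e2 by rewrite divr_gt0.
  have ut0 : 0 < u - t by rewrite subr_gt0.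
  pose B : set (R * R) := `]u - t, u - t + e2[%classic `*` `]t, t + e2[%classic.
  have mB : measurable B by exact: measurableX.
  have B0 : (0 < leb2 B)%E.
    rewrite /leb2 product_measure1E// [X in (X * _)%E]leb_itvoo ?ltrDl//.
    rewrite [X in (_ * X)%E]leb_itvoo ?ltrDl//.
    by rewrite -EFinM lte_fin mulr_gt0// (addrC _ e2) addrK.
  have /existsNP[p /not_implyP[]] : ~ (B `<=` N).
    by move=> BN; have : (leb2 B <= leb2 N)%E := le_measure leb2 (mem_set mB) (mem_set mN) BN; rewrite N0 leNgt B0.
  case: p => r t' [/=]; rewrite !in_itv/= => /andP[r1 r2] /andP[t1 t2] pN.
  have r0 : 0 < r := lt_trans ut0 r1.
  have e2e : e2 + e2 = e by rewrite /e2 -splitr.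
  exists t', (t' + r); split.
  - by rewrite t1/=; move: t2 e2e e20; lra.
  - by move: r1 r2 t1 t2 e2e e20; lra.
  - by rewrite ltrDl.
  have : trace nu1 (r, t') = c * trace nu2 (r, t').
    by apply: contrapT => h; apply: pN; apply: sN.
  rewrite /trace/= mulrCA => /mulfI; apply.
  by rewrite gt_eqF// window_weight_gt0.
have fin (nu : {finite_measure set R -> \bar R}) (x y : R) :
    nu `]x, y]%classic \is a fin_num by rewrite fin_num_measure.
have splitI (nu : {finite_measure set R -> \bar R}) (x y z : R) : x <= y -> y <= z ->
    fine (nu `]x, z]%classic) = fine (nu `]x, y]%classic) + fine (nu `]y, z]%classic).
  move=> xy yz; rewrite -fineD// -measureU//.
    congr (fine (nu _)); apply/seteqP; split => w /=; rewrite !in_itv/=.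
      by move=> /andP[h1 h2]; have [h|h] := leP w y; [left|right]; rewrite ?h1 ?h ?h2.
    by move=> [|] /andP[h1 h2]; lra.
  apply/seteqP; split => // w /=; rewrite !in_itv/= => -[/andP[_ h1] /andP[h2 _]].
  by rewrite leNgt h2 in h1.
have mono (nu : {finite_measure set R -> \bar R}) (x y z : R) : y <= z ->
    fine (nu `]x, y]%classic) <= fine (nu `]x, z]%classic).
  move=> yz; rewrite fine_le// le_measure ?inE// => w /=; rewrite !in_itv/= => /andP[-> h]/=.
  exact: le_trans yz.
have fge0 (nu : {finite_measure set R -> \bar R}) (x y : R) : 0 <= fine (nu `]x, y]%classic).
  exact: fine_ge0.
have tail n : `|fine (nu1 `]t, u]%classic) - c * fine (nu2 `]t, u]%classic)| <=
    fine (nu1 `]t, t + n.+1%:R^-1]%classic) + fine (nu1 `]u, u + n.+1%:R^-1]%classic) +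
    `|c| * (fine (nu2 `]t, t + n.+1%:R^-1]%classic) + fine (nu2 `]u, u + n.+1%:R^-1]%classic)).
  have e0 : 0 < n.+1%:R^-1 :> R by rewrite invr_gt0.
  have [t' [u' [/andP[t1 t2] /andP[u1 u2] tu' E]]] := good _ e0.
  have D (nu : {finite_measure set R -> \bar R}) :
     `|fine (nu `]t, u]%classic) - fine (nu `]t', u']%classic)| <=
     fine (nu `]t, t + n.+1%:R^-1]%classic) + fine (nu `]u, u + n.+1%:R^-1]%classic).
    have := splitI nu t u u' (ltW tu) (ltW u1).
    rewrite (splitI nu t t' u' (ltW t1) (ltW tu')) => h.
    have := mono nu t _ _ t2; have := mono nu u _ _ u2.
    have := fge0 nu t t'; have := fge0 nu u u'.
    by move=> *; rewrite ler_norml; lra.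
  have -> : fine (nu1 `]t, u]%classic) - c * fine (nu2 `]t, u]%classic) =
    (fine (nu1 `]t, u]%classic) - fine (nu1 `]t', u']%classic)) -
    c * (fine (nu2 `]t, u]%classic) - fine (nu2 `]t', u']%classic)) by rewrite E; ring.
  apply: (le_trans (ler_normB _ _)); rewrite lerD ?D//.
  by rewrite normrM ler_wpM2l ?D.
apply/eqP; rewrite -subr_eq0 -normr_le0.
set L := `|_|.
have cv : (fine (nu1 `]t, t + n.+1%:R^-1]%classic) + fine (nu1 `]u, u + n.+1%:R^-1]%classic) +
    `|c| * (fine (nu2 `]t, t + n.+1%:R^-1]%classic) + fine (nu2 `]u, u + n.+1%:R^-1]%classic)))
    @[n --> \oo] --> (0 + 0 + `|c| * (0 + 0) : R).
  apply: cvgD; first by apply: cvgD; exact: measure_itv_shrink.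
  apply: cvgM; first exact: cvg_cst.
  by apply: cvgD; exact: measure_itv_shrink.
have z0 : 0 + 0 + `|c| * (0 + 0) = 0 :> R by ring.
rewrite {}z0 in cv.
rewrite -(cvg_lim _ cv)//; apply: limr_ge; first by apply/cvg_ex; exists 0.
by apply: nearW => n; exact: tail.
Qed.

(** Half-open intervals are stable under intersection and generate the Borel sets. The factor [c]
    serves both uniqueness (c = 1) and the identification with [q sigma] (c = q). *)
Lemma trace_unique (nu1 nu2 : {finite_measure set R -> \bar R}) (c : R) : 0 <= c ->
  {ae leb2, forall p, trace nu1 p = c * trace nu2 p} ->
  forall A, measurable A -> nu1 A = (c%:E * nu2 A)%E.
Proof.
move=> c0 H A mA; pose m2 := mscale (NngNum c0) nu2.
suff : nu1 A = m2 A by [].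
pose g (n : nat) : set R := `]- n%:R, n%:R]%classic.
have sub : @ocitv R `<=` (measurable : set (set R)).
  by move=> _ [x _ <-].
apply: (@g_sigma_algebra_measure_unique _ _ _ (@ocitv R) sub g _ _ nu1 m2) => //.
- by move=> n; exact: is_ocitv.
- apply/seteqP; split => // x _; exists (Num.bound `|x|).+1 => //=.
  have h : `|x| < (Num.bound `|x|).+1%:R.
    by rewrite (lt_le_trans (archi_boundP _))// ler_nat.
  by rewrite /g/= in_itv/=; move: h; rewrite ltr_norml => /andP[-> /ltW].
- exact: ocitvI.
- move=> _ [[t u] _ <-] /=; rewrite /m2 /mscale/=.
  have [tu|ut] := ltP t u; last by rewrite set_itv_ge ?bnd_simp -?leNgt// !measure0 mule0.
  have f1 : nu1 `]t, u]%classic \is a fin_num by rewrite fin_num_measure.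
  have f2 : nu2 `]t, u]%classic \is a fin_num by rewrite fin_num_measure.
  by rewrite -(fineK f1) -(fineK f2) (trace_inj H tu) EFinM.
- by move=> n; rewrite -ge0_fin_numE// fin_num_measure//; exact: measurable_itv.
Qed.

End trace.

(** * Helly selection *)

Section diagonal_extraction.
Variable R : realType.

Let increasing_infl (f : nat -> nat) : increasing_seq f -> forall n, (n <= f n)%N.
Proof.
move=> fi; elim=> // n ih; apply: (leq_ltn_trans ih).
by have := leW_mono fi n n.+1; rewrite !ltEnat /= ltnS leqnn.
Qed.

Lemma diagonal_extraction (u : nat -> nat -> R) (M : R) :
  (forall i n, `|u i n| <= M) ->
  exists phi : nat -> nat, (forall n, (n <= phi n)%N) /\
    forall i, cvgn (fun n => u i (phi n)).
Proof.
move=> uM.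
have BW (v : nat -> R) : (forall n, `|v n| <= M) ->
    {f : nat -> nat | (forall n, (n <= f n)%N) /\ cvgn (v \o f)}.
  move=> vM; apply: cid.
  have [|f fi fc] := @bolzano_weierstrass R v.
    exists M; split; first exact: num_real.
    by move=> x Mx n _ /=; exact: le_trans (vM n) (ltW Mx).
  by exists f; split => //; exact: increasing_infl.
have uM' i (f : nat -> nat) n : `|(u i \o f) n| <= M by exact: uM.
(* [G k] is an extraction along which the first k + 1 rows converge; the diagonal is, from rank i
   on, a reindexing of [G i] whose indices dominate n ([Gsub]). *)
pose fix G (k : nat) : nat -> nat := if k is k'.+1
  then G k' \o sval (BW _ (uM' k (G k'))) else sval (BW _ (uM 0%N)).
have Gcvg i : cvgn (u i \o G i).
  case: i => [|i] /=; first by case: (svalP (BW _ (uM 0%N))).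
  by case: (svalP (BW _ (uM' i.+1 (G i)))).
have Ginfl i n : (n <= G i n)%N.
  elim: i n => [|i ih] n /=; first by case: (svalP (BW _ (uM 0%N))).
  by apply: (leq_trans _ (ih _)); case: (svalP (BW _ (uM' i.+1 (G i)))).
have Gsub i j x : exists2 y, (x <= y)%N & G (j + i)%N x = G i y.
  elim: j x => [|j ih] x; first by exists x.
  rewrite addSn /=; have [y h1 h2] := ih (sval (BW _ (uM' (j + i).+1 (G (j + i)%N))) x).
  exists y => //; apply: (leq_trans _ h1).
  by case: (svalP (BW _ (uM' (j + i).+1 (G (j + i)%N)))).
exists (fun n => G n n); split => // i.
have /cvg_ex[/= l ul] := Gcvg i; apply/cvg_ex; exists l.
apply/cvgrPdist_le => e e0; move/cvgrPdist_le: ul => /(_ e e0)[K _ hK].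
exists (maxn K i) => // n /=; rewrite geq_max => /andP[Kn iN].
have [y ny Gy] := Gsub i (n - i)%N n; rewrite subnK// in Gy.
by rewrite Gy; apply: hK => /=; exact: leq_trans ny.
Qed.

End diagonal_extraction.

Section borel_transfer.
Variables (R : realType) (m : {measure set (measurableTypeR R) -> \bar R}).

(* [measurableTypeR R] and [R] carry the same sigma-algebra in different
   structures *)
Definition measure_on_R : set R -> \bar R := pushforward m (idfun : measurableTypeR R -> R).

Let m0 : measure_on_R set0 = 0%E. Proof. exact: (@measure0 _ _ _ m). Qed.

Let m_ge0 A : (0 <= measure_on_R A)%E. Proof. exact: (@measure_ge0 _ _ _ m). Qed.

Let m_sigma_additive : semi_sigma_additive measure_on_R.
Proof. exact: (@measure_semi_sigma_additive _ _ _ m). Qed.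

HB.instance Definition _ :=
  isMeasure.Build _ _ _ measure_on_R m0 m_ge0 m_sigma_additive.

End borel_transfer.

Section stieltjes.
Variables (R : realType) (F : R -> R).

Definition as_cumulative of nondecreasing F & right_continuous F : R -> R := F.

Section instance.
Hypotheses (ndF : nondecreasing F) (rcF : right_continuous F).
HB.instance Definition _ := isCumulative.Build R _ R (as_cumulative ndF rcF) ndF rcF.
End instance.

Lemma itv_oc_bigcup : \bigcup_n `](- n%:R)%R, n%:R]%classic = [set: R].
Proof.
apply/seteqP; split => // x _; exists (Num.bound `|x|).+1 => //=.
have h : `|x| < (Num.bound `|x|).+1%:R.
  by rewrite (lt_le_trans (archi_boundP _))// ler_nat.
by rewrite in_itv/=; move: h; rewrite ltr_norml => /andP[-> /ltW].
Qed.

Lemma nondecreasing_itv_oc : nondecreasing_seq (fun n => `](- n%:R)%R, n%:R : R]%classic).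
Proof.
move=> m n mn; apply/subsetPset => x; rewrite /= !in_itv/= => /andP[h1 h2].
have mnR : m%:R <= n%:R :> R by rewrite ler_nat.
by rewrite (le_lt_trans _ h1) ?lerN2// (le_trans h2).
Qed.

Lemma stieltjes_measure_exists (a b : R) : nondecreasing F -> right_continuous F ->
  (forall x, a <= F x <= b) ->
  exists mu : {finite_measure set R -> \bar R}, (mu setT <= (b - a)%:E)%E /\
    forall x y, x <= y -> mu `]x, y]%classic = (F y - F x)%:E.
Proof.
move=> ndF rcF Fab.
pose m0 := lebesgue_stieltjes_measure (as_cumulative ndF rcF).
pose m : {measure set R -> \bar R} := measure_on_R m0.
have mE x y : x <= y -> m `]x, y]%classic = (F y - F x)%:E.
  move=> xy; transitivity (m0 `]x, y]%classic) => //.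
  rewrite /m0 /lebesgue_stieltjes_measure /measure_extension/= measurable_mu_extE/=.
    by rewrite wlength_itv_bnd.
  exact: is_ocitv.
have mT : (m setT <= (b - a)%:E)%E.
  rewrite -itv_oc_bigcup.
  have cv : m `](- n%:R)%R, n%:R]%classic @[n --> \oo] -->
      m (\bigcup_n `](- n%:R)%R, n%:R]%classic).
    apply: nondecreasing_cvg_mu => //; last exact: nondecreasing_itv_oc.
    exact: bigcup_measurable.
  rewrite -(cvg_lim _ cv)//; apply: lime_le; first by apply/cvg_ex; eexists; exact: cv.
  apply: nearW => n; rewrite mE ?lee_fin; last by rewrite (@le_trans _ _ 0) ?oppr_le0.
  by have /andP[] := Fab n%:R; have /andP[] := Fab (- n%:R); lra.
have moo : (m setT < +oo)%E by rewrite (le_lt_trans mT)// ltry.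
exists (as_finite moo); split => //.
Qed.

End stieltjes.

Section helly.
Variable R : realType.
Local Notation leb := (@leb R).

(** By Tonelli, the integral over [m] of the mass of {g x} is the integral over [mu] of the
    [m]-measure of a fibre of [g], which is 0. Used with [g] giving either endpoint of a window:
    almost no window ends at an atom. *)
Lemma ae_not_atom d (T : measurableType d) (m : {sigma_finite_measure set T -> \bar R})
    (mu : {finite_measure set R -> \bar R}) (g : T -> R) :
  measurable_fun setT g -> (forall y, m (g @^-1` [set y]) = 0%E) ->
  {ae m, forall x, mu [set g x] = 0%E}.
Proof.
move=> mg g0.
pose f (z : T * R) : \bar R := (if g z.1 == z.2 then 1 else 0)%E.
have mf : measurable_fun setT f.
  apply: measurable_fun_ifT => //; apply: measurable_fun_eqr => //.
  exact: (measurableT_comp mg measurable_fst).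
have f0 z : (0 <= f z)%E by rewrite /f; case: ifP.
have slice x : (\int[mu]_y f (x, y) = mu [set g x])%E.
  rewrite -[X in mu X]setIT -integral_indic//; apply: eq_integral => y _.
  rewrite /f indicE /= eq_sym; case: eqP => [->|yx]; first by rewrite mem_set.
  by rewrite memNset.
have I : (\int[m]_x `|mu [set g x]| = 0)%E.
  rewrite (eq_integral (fun x => \int[mu]_y f (x, y))%E); last first.
    by move=> x _; rewrite slice gee0_abs.
  rewrite (@fubini_tonelli _ _ _ _ _ m mu f)//.
  rewrite (eq_integral (fun=> 0%E)) ?integral0// => y _.
  have mgy : measurable (g @^-1` [set y]) by rewrite -[X in measurable X]setTI; exact: mg.
  rewrite (eq_integral (fun x => (\1_(g @^-1` [set y]) x)%:E)).
    by rewrite integral_indic// setIT; exact: g0.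
  move=> x _; rewrite /f indicE /=; case: eqP => [gx|gx]; first by rewrite mem_set.
  by rewrite memNset.
have mm : measurable_fun setT (fun x => mu [set g x]).
  rewrite (_ : (fun _ => _) = fun x => (\int[mu]_y f (x, y))%E); last first.
    by apply/funext => x; rewrite slice.
  exact: (@measurable_fun_fubini_tonelli_F _ _ _ _ _ mu f).
have := (ae_eq_integral_abs m measurableT mm).1 I.
by apply: filterS => x /(_ Logic.I).
Qed.

Lemma leb_set1 (y : R) : leb [set y] = 0%E.
Proof. by transitivity (@lebesgue_measure R [set y]) => //; exact: lebesgue_measure_set1. Qed.

Lemma leb2_snd_eq (y : R) : @leb2 R (snd @^-1` [set y]) = 0%E.
Proof.
rewrite (_ : _ @^-1` _ = setT `*` [set y]); last first.
  by apply/seteqP; split => [[r t]|[r t]]//= [].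
by rewrite /leb2 product_measure1E// [X in (_ * X)%E]leb_set1 mule0.
Qed.

Lemma leb2_add_eq (y : R) : @leb2 R ((fun p => p.2 + p.1) @^-1` [set y]) = 0%E.
Proof.
rewrite /leb2 /product_measure1 /=.
rewrite (eq_integral (fun=> 0%E)) ?integral0// => r _ /=.
rewrite [X in leb X](_ : _ = [set y - r]) ?leb_set1//.
apply/seteqP; split => t /=; rewrite /xsection/= inE/=; first by move=> <-; rewrite addrK.
by move=> ->; rewrite subrK.
Qed.

Let rat_dense (x y : R) : x < y -> exists i : nat, x < ratr (odflt 0 (unpickle i) : rat) < y.
Proof.
move=> xy; have [q] := rat_in_itvoo xy; rewrite in_itv/= => h.
by exists (pickle q); rewrite pickleK.
Qed.

(** Mass may escape to infinity along the sequence, so only an upper bound on the mass survives;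
    convergence is claimed where the limit has no atom. *)
Lemma helly (nu : nat -> {finite_measure set R -> \bar R}) :
  (forall n, nu n setT <= 1)%E ->
  exists (phi : nat -> nat) (mu : {finite_measure set R -> \bar R}),
  [/\ forall n, (n <= phi n)%N, (mu setT <= 1)%E &
    forall t u, t <= u -> mu [set t] = 0%E -> mu [set u] = 0%E ->
      fine (nu (phi n) `]t, u]%classic) @[n --> \oo] --> fine (mu `]t, u]%classic)].
Proof.
move=> nu1.
pose F n x : R := fine (nu n `]-oo, x]%classic).
have fin n x : nu n `]-oo, x]%classic \is a fin_num by rewrite fin_num_measure.
have Fnd n x y : x <= y -> F n x <= F n y.
  move=> xy; rewrite fine_le// le_measure ?inE// => z /=; rewrite !in_itv/= => h.
  exact: le_trans xy.
have F0 n x : 0 <= F n x by exact: fine_ge0.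
have F1 n x : F n x <= 1.
  rewrite -[leRHS]/(fine 1%E) fine_le//; apply: le_trans (nu1 n).
  by rewrite le_measure ?inE.
pose q i : R := ratr (odflt 0 (unpickle i) : rat).
have [phi [phi_infl phi_cvg]] := @diagonal_extraction R (fun i n => F n (q i)) 1
  (fun i n => ltac:(by rewrite ger0_norm)).
pose G i := limn (fun n => F (phi n) (q i)).
have GE i : F (phi n) (q i) @[n --> \oo] --> G i by exact: phi_cvg.
have G01 i : 0 <= G i <= 1.
  apply/andP; split; [apply: limr_ge => //|apply: limr_le => //]; exact: nearW.
(* Taking the infimum over strictly larger rationals makes [H] right-continuous, as a cumulative
   function must be; it need not agree with [G] at the rationals themselves. *)
pose H x := inf [set G i | i in [set i | x < q i]].
have Hlb x : lbound [set G i | i in [set i | x < q i]] 0.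
  by move=> _ [i _ <-]; have /andP[] := G01 i.
have Hne x : [set G i | i in [set i | x < q i]] !=set0.
  by have [i /andP[xi _]] := @rat_dense x (x + 1) ltac:(by rewrite ltrDl); exists (G i), i.
have Hinf x : has_inf [set G i | i in [set i | x < q i]] by split; [exact: Hne|exists 0].
have H_le x i : x < q i -> H x <= G i.
  by move=> xi; apply: ge_inf; [by case: (Hinf x)|exists i].
have H_lt x e : 0 < e -> exists2 i, x < q i & G i < H x + e.
  by move=> e0; have [_ [i xi <-] h] := inf_adherent e0 (Hinf x); exists i.
have Hnd : nondecreasing H.
  move=> x y xy; apply: lb_le_inf => // _ [i yi <-]; apply: H_le.
  exact: le_lt_trans yi.
have H01 x : 0 <= H x <= 1.
  apply/andP; split; first exact: lb_le_inf.
  have [g [i xi _]] := Hne x; apply: (le_trans (H_le _ _ xi)).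
  by have /andP[] := G01 i.
have Hrc : right_continuous H.
  move=> x; apply/cvgrPdist_le => e e0; have [i xi hi] := H_lt x e e0.
  near=> y; have xy : x <= y by apply/ltW; near: y; exact: nbhs_right_gt.
  have yi : y < q i by near: y; exact: nbhs_right_lt.
  have := Hnd _ _ xy; have := H_le _ _ yi => h1 h2.
  by rewrite ler_norml; lra.
have [mu [muT muE]] := stieltjes_measure_exists Hnd Hrc H01.
exists phi, mu; split => //; first by rewrite subr0 in muT.
(* The absence of an atom is left continuity of [H]. *)
have left_cont x e : mu [set x] = 0%E -> 0 < e -> exists2 y, y < x & H x - H y < e.
  move=> mux e0.
  have cv : mu `]x - n.+1%:R^-1, x]%classic @[n --> \oo] --> (0 : \bar R).
    rewrite -mux.
    have -> : [set x] = \bigcap_n `]x - n.+1%:R^-1, x]%classic.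
      apply/seteqP; split => [_ -> n _ /=|y h] /=.
        by rewrite in_itv/= lexx andbT ltrBlDr ltrDl invr_gt0.
      have yx : y <= x by have := h 0%N Logic.I; rewrite /= in_itv/= => /andP[].
      apply/eqP; rewrite eq_le yx leNgt; apply/negP => ylx.
      have yx0 : 0 < x - y by rewrite subr_gt0.
      have := h (Num.bound (x - y)^-1) Logic.I; rewrite /= in_itv/= => /andP[+ _].
      rewrite ltrBlDr -ltrBlDl ltNge => /negP; apply.
      rewrite invf_ple ?posrE//; apply: le_trans (ltW (archi_boundP _)) _.
        by rewrite invr_ge0 ltW.
      by rewrite ler_nat.
    apply: nonincreasing_cvg_mu => //.
    - by rewrite -ge0_fin_numE// fin_num_measure.
    - exact: bigcap_measurable.
    - move=> m n mn; apply/subsetPset => y; rewrite /= !in_itv/= => /andP[h ->].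
      by rewrite andbT (le_lt_trans _ h)// lerD2l lerN2 lef_pV2 ?posrE// ler_nat.
  have /fine_cvgP[_ /cvgrPdist_lt /(_ e e0)[n _ /(_ n (leqnn n))]] := cv.
  rewrite /= sub0r normrN => h; exists (x - n.+1%:R^-1); first by rewrite ltrBlDr ltrDl invr_gt0.
  have xn : x - n.+1%:R^-1 <= x by rewrite gerBl invr_ge0.
  by apply: le_lt_trans h; rewrite (muE _ _ xn)/=; exact: ler_norm.
(* [F (phi n) x] is squeezed between its values at rationals [q j] < x < [q i], whose limits are
   within e / 2 of [H x]. *)
have Fcv x : mu [set x] = 0%E -> F (phi n) x @[n --> \oo] --> H x.
  move=> mux; apply/cvgrPdist_le => e e0; have e20 : 0 < e / 2 by rewrite divr_gt0.
  have [y yx hy] := left_cont x _ mux e20.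
  have [i xi hi] := H_lt x _ e20.
  have [j /andP[yj jx]] := rat_dense yx.
  have hj : H y <= G j := H_le _ _ yj.
  have /cvgrPdist_le/(_ _ e20) ci := GE i; have /cvgrPdist_le/(_ _ e20) cj := GE j.
  near=> n.
  have : `|G i - F (phi n) (q i)| <= e / 2 by near: n; exact: ci.
  have : `|G j - F (phi n) (q j)| <= e / 2 by near: n; exact: cj.
  have := Fnd (phi n) _ _ (ltW xi); have := Fnd (phi n) _ _ (ltW jx).
  by rewrite !ler_norml => h1 h2 /andP[h3 h4] /andP[h5 h6]; lra.
move=> t u tu mut muu.
have -> : fine (mu `]t, u]%classic) = H u - H t by rewrite muE.
rewrite (_ : (fun n => _) = (fun n => F (phi n) u - F (phi n) t)); first exact: cvgB (Fcv _ muu) (Fcv _ mut).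
apply/funext => n; rewrite /F.
have -> : `]-oo, u]%classic = `]-oo, t]%classic `|` `]t, u]%classic :> set R.
  apply/seteqP; split => z /=; rewrite !in_itv/=.
    by move=> zu; have [zt|tz] := leP z t; [left|right].
  by move=> [zt|/andP[]//]; exact: le_trans tu.
rewrite measureU// ?fineD ?fin_num_measure//; first by rewrite addrC addKr.
by apply/seteqP; split => // z /=; rewrite !in_itv/= => -[h1 /andP[h2 _]]; rewrite leNgt h2 in h1.
Unshelve. all: by end_near. Qed.

End helly.

(** * Fatou's lemma with numerical bounds, and operations on finite measures *)

Section fatou_bound.
Context d (T : measurableType d) (R : realType).
Variable mu : {measure set T -> \bar R}.

Lemma fatou_cvg (f : nat -> T -> \bar R) (g : T -> \bar R) (c : nat -> R) (l : R) :
  (forall n, measurable_fun setT (f n)) -> (forall n x, (0 <= f n x)%E) ->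
  measurable_fun setT g -> (forall x, (0 <= g x)%E) ->
  {ae mu, forall x, f n x @[n --> \oo] --> g x} ->
  (forall n, (\int[mu]_x f n x <= (c n)%:E)%E) -> c n @[n --> \oo] --> l ->
  (\int[mu]_x g x <= l%:E)%E.
Proof.
move=> mf f0 mg g0 [N [mN N0 sN]] fc cl.
have mA : measurable (setT `\` N) by exact: measurableD.
rewrite (@ge0_negligible_integral _ _ _ mu setT N g)//.
have gE : {in setT `\` N, g =1 (fun x => limn_einf (f^~ x))}.
  move=> x; rewrite inE => -[_ Nx]; apply/esym.
  have fx : f n x @[n --> \oo] --> g x by apply: contrapT => h; apply: Nx; exact: sN.
  by have [-> _] := cvg_limn_einf_sup fx.
rewrite (eq_integral _ _ gE).
apply: le_trans (fatou mu mA (fun n => measurable_funTS (mf n)) (fun n x _ => f0 n x)) _.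
have cl' : (c n)%:E @[n --> \oo] --> l%:E.
  by apply/fine_cvgP; split => //; exact: nearW.
have [<- _] := cvg_limn_einf_sup cl'.
rewrite !limn_einf_lim; apply: lee_lim; [exact: is_cvg_einfs|exact: is_cvg_einfs|].
apply: nearW => n; apply: le_ereal_inf_tmp => _ [m /= nm <-].
apply: (@le_trans _ _ (\int[mu]_(x in setT `\` N) f m x)%E).
  by apply: ereal_inf_lbound; exists m.
apply: le_trans (fc m); apply: ge0_subset_integral => //.
Qed.

End fatou_bound.

Section finite_measure_operations.
Context d (T : measurableType d) (R : realType).
Implicit Types nu : {finite_measure set T -> \bar R}.

Lemma finite_measure_fineK nu A : measurable A -> (fine (nu A))%:E = nu A.
Proof. by move=> mA; rewrite fineK// fin_num_measure. Qed.

Lemma finite_measure_combination nu1 nu2 (c1 c2 : R) : 0 <= c1 -> 0 <= c2 ->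
  exists nu, forall A, measurable A -> nu A = (c1%:E * nu1 A + c2%:E * nu2 A)%E.
Proof.
move=> c10 c20.
pose m : {measure set T -> \bar R} :=
  measure_add (mscale (NngNum c10) nu1) (mscale (NngNum c20) nu2).
have mE A : m A = (c1%:E * nu1 A + c2%:E * nu2 A)%E.
  exact: measure_addE.
have moo : (m setT < +oo)%E.
  by rewrite mE -(finite_measure_fineK nu1 measurableT)
    -(finite_measure_fineK nu2 measurableT) -!EFinM -EFinD ltry.
by exists (as_finite moo) => A _; rewrite -mE.
Qed.

Lemma finite_measure_restriction nu (A : set T) : measurable A ->
  exists rho : {finite_measure set T -> \bar R},
    (forall B, measurable B -> rho B = nu (B `&` A)) /\
    forall f, measurable_fun setT f -> (forall x, (0 <= f x)%E) ->
      (\int[rho]_x f x = \int[nu]_(x in A) f x)%E.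
Proof.
move=> mA.
have h0 x : 0 <= (\1_A x : R) by [].
have mh : measurable_fun setT (\1_A : T -> R) by exact: measurable_indic.
have mE B : measurable B -> density nu h0 mh B = nu (B `&` A).
  by move=> mB; rewrite /density integral_indic// setIC.
have moo : (density nu h0 mh setT < +oo)%E.
  by rewrite mE// -finite_measure_fineK ?ltry//; exact: measurableI.
exists (as_finite moo); split => [|f mf f0]; first exact: mE.
transitivity (\int[density nu h0 mh]_x f x)%E => //.
rewrite ge0_integral_density// [RHS]integral_mkcond.
by apply: eq_integral => x _; rewrite epatch_indic.
Qed.

End finite_measure_operations.

(** * The weighted energy and its relaxation *)

Section weighted_energy.
Variables (R : realType) (s q a b : R).
Hypotheses (s_gt0 : 0 < s) (q_gt0 : 0 < q) (b_neq0 : b != 0).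
Variable sigma : probability R R.
Local Notation N := (@dist_charge R a b).
Local Notation leb := (@leb R).
Local Notation leb2 := (@leb2 R).
Local Notation tr := (@trace R s).
Local Notation ip := (L2ip leb2).
Implicit Types nu rho : {finite_measure set R -> \bar R}.

Hypothesis sigma_potential :
  forall x, (\int[sigma]_y riesz_kernel s x y = (N x `^ (- s))%:E)%E.

Definition potential (nu : set R -> \bar R) (x : R) : \bar R :=
  (\int[nu]_y riesz_kernel s x y)%E.

Lemma potential_ge0 nu x : (0 <= potential nu x)%E.
Proof. by apply: integral_ge0 => y _; exact: riesz_kernel_ge0. Qed.

Lemma measurable_potential nu : measurable_fun setT (potential nu).
Proof.
apply: (@measurable_fun_fubini_tonelli_F _ _ _ _ _ nu
  (fun z : R * R => riesz_kernel s z.1 z.2)); first exact: measurable_riesz_kernel.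
by move=> z; exact: riesz_kernel_ge0.
Qed.

Lemma charge_potential_bound x : N x `^ (- s) <= `|b| `^ (- s).
Proof.
apply: le0_powR; rewrite ?oppr_le0 ?normr_gt0 ?(ltW s_gt0)//.
exact: dist_charge_ge.
Qed.

Lemma measurable_charge_potential : measurable_fun setT (fun x => (N x `^ (- s))%:E).
Proof. by apply/measurable_EFinP; exact: measurable_dist_charge_powR. Qed.

Lemma integral_charge_fin nu : (\int[nu]_x (N x `^ (- s))%:E < +oo)%E.
Proof.
apply: (@le_lt_trans _ _ (\int[nu]_x (cst (`|b| `^ (- s))%:E) x)%E).
  apply: ge0_le_integral => //.
  - by move=> x _; rewrite lee_fin powR_ge0.
  - exact: measurable_charge_potential.
  - by move=> x _; rewrite lee_fin charge_potential_bound.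
by rewrite integral_cst//= -finite_measure_fineK// -EFinM ltry.
Qed.

Lemma L2_trace_sigma : L2 leb2 (tr sigma).
Proof.
apply/(L2_trace s_gt0).
by under eq_integral do rewrite sigma_potential; exact: integral_charge_fin.
Qed.
Local Hint Resolve L2_trace_sigma : core.

Lemma integral_potential nu rho : L2 leb2 (tr nu) -> L2 leb2 (tr rho) ->
  (\int[rho]_x potential nu x = (ip (tr rho) (tr nu))%:E)%E.
Proof. by move=> h1 h2; rewrite -mutual_energy_L2ip. Qed.

Lemma integral_charge_potential rho : L2 leb2 (tr rho) ->
  (\int[rho]_x (N x `^ (- s))%:E = (ip (tr rho) (tr sigma))%:E)%E.
Proof.
move=> h; rewrite -integral_potential//.
by apply: eq_integral => x _; rewrite -sigma_potential.
Qed.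

Definition signed_trace (nu : set R -> \bar R) (p : R * R) : R := tr nu p - q * tr sigma p.

(* Squared L2 norm of [f_nu - q f_sigma]: the weighted energy up to the constant
   [q^2 I(sigma)], but meaningful for any mass. *)
Definition energy_gap (nu : set R -> \bar R) : R :=
  ip (signed_trace nu) (signed_trace nu).

Lemma L2_signed_trace nu : L2 leb2 (tr nu) -> L2 leb2 (signed_trace nu).
Proof. by move=> h; apply: L2B => //; exact: L2Z. Qed.

Lemma signed_ipE nu rho : L2 leb2 (tr nu) -> L2 leb2 (tr rho) ->
  ip (signed_trace nu) (tr rho) = ip (tr rho) (tr nu) - q * ip (tr rho) (tr sigma).
Proof.
move=> h1 h2; rewrite /signed_trace L2ipBl//; last exact: L2Z.
by rewrite L2ipZl// (L2ipC _ (tr nu)) (L2ipC _ (tr sigma)).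
Qed.

(** Expansion of the square: [sigma_potential] turns the field term into the scalar product of the
    traces of [nu] and [sigma]. *)
Lemma weighted_energyE (nu : probability R R) : L2 leb2 (tr nu) ->
  weighted_energy s q a b nu = (energy_gap nu - q ^+ 2 * ip (tr sigma) (tr sigma))%:E.
Proof.
move=> h; have hV := L2_signed_trace h.
have -> : energy_gap nu - q ^+ 2 * ip (tr sigma) (tr sigma) =
    ip (tr nu) (tr nu) + 2 * (- q * ip (tr nu) (tr sigma)).
  rewrite /energy_gap {1}/signed_trace L2ipBl//; last exact: L2Z.
  rewrite L2ipZl// (L2ipC _ (tr nu)) (L2ipC _ (tr sigma)) !signed_ipE//.
  by rewrite (L2ipC _ (tr sigma) (tr nu)); ring.
have e1 : riesz_energy s nu = (ip (tr nu) (tr nu))%:E by exact: mutual_energy_L2ip.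
have e2 : (\int[nu]_x (ext_field s q a b x)%:E)%E = (- q * ip (tr nu) (tr sigma))%:E.
  rewrite EFinM -integral_charge_potential// -integralZl//.
  apply/integrableP; split; first exact: measurable_charge_potential.
  under eq_integral do rewrite gee0_abs ?lee_fin ?powR_ge0//.
  exact: integral_charge_fin.
by rewrite /weighted_energy e1 e2 -EFinM -EFinD.
Qed.

(** The field is bounded on the line, since the charge is at distance |b| > 0 from it, so it cannot
    compensate an infinite Riesz energy. *)
Lemma weighted_energy_pinfty (nu : probability R R) : ~ L2 leb2 (tr nu) ->
  weighted_energy s q a b nu = +oo%E.
Proof.
move=> h; rewrite /weighted_energy.
have -> : riesz_energy s nu = +oo%E.
  apply/eqP; rewrite -leye_eq leNgt; apply/negP => hI; apply: h.
  exact/(L2_trace s_gt0).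
rewrite addye//.
have -> : (\int[nu]_x (ext_field s q a b x)%:E)%E =
    ((- q)%:E * \int[nu]_x (N x `^ (- s))%:E)%E.
  rewrite -integralZl//; apply/integrableP; split; first exact: measurable_charge_potential.
  under eq_integral do rewrite gee0_abs ?lee_fin ?powR_ge0//.
  exact: integral_charge_fin.
have : (\int[nu]_x (N x `^ (- s))%:E)%E \is a fin_num.
  by rewrite ge0_fin_numE ?integral_charge_fin//; apply: integral_ge0 => x _; rewrite lee_fin powR_ge0.
by move=> /fineK <-.
Qed.

Lemma trace_combination nu nu1 nu2 (c1 c2 : R) :
  (forall A, measurable A -> nu A = (c1%:E * nu1 A + c2%:E * nu2 A)%E) ->
  tr nu = (fun p => c1 * tr nu1 p + c2 * tr nu2 p).
Proof.
move=> nuE; apply/funext => p; rewrite /trace nuE//.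
have m := measurable_itv (Interval (BRight p.2) (BRight (p.2 + p.1))).
rewrite -(finite_measure_fineK nu1 m) -(finite_measure_fineK nu2 m).
by rewrite -!EFinM -EFinD /=; ring.
Qed.

Lemma L2_trace_le nu rho : (forall A, measurable A -> nu A <= rho A)%E ->
  L2 leb2 (tr rho) -> L2 leb2 (tr nu).
Proof.
move=> nr [_ I]; split; first exact: measurable_trace.
apply: le_lt_trans I; apply: ge0_le_integral => //.
- by move=> p _; rewrite lee_fin sqr_ge0.
- by apply/measurable_EFinP; apply: measurable_funX; exact: measurable_trace.
- by apply/measurable_EFinP; apply: measurable_funX; exact: measurable_trace.
- move=> p _; rewrite lee_fin ler_sqr ?nnegrE ?trace_ge0//.
  by rewrite ler_wpM2l ?window_weight_ge0// fine_le ?fin_num_measure ?nr.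
Qed.

Lemma trace_ae_cvg (nu : nat -> {finite_measure set R -> \bar R})
    (mu : {finite_measure set R -> \bar R}) :
  (forall t u, t <= u -> mu [set t] = 0%E -> mu [set u] = 0%E ->
    fine (nu n `]t, u]%classic) @[n --> \oo] --> fine (mu `]t, u]%classic)) ->
  {ae leb2, forall p, tr (nu n) p @[n --> \oo] --> tr mu p}.
Proof.
move=> H.
have m2 : measurable_fun setT (snd : R * R -> R) by exact: measurable_snd.
have ma : measurable_fun setT (fun p : R * R => p.2 + p.1).
  by apply: measurable_funD; [exact: measurable_snd|exact: measurable_fst].
have A1 := @ae_not_atom R _ _ leb2 mu _ m2 (@leb2_snd_eq R).
have A2 := @ae_not_atom R _ _ leb2 mu _ ma (@leb2_add_eq R).
move: A1 A2; apply: filterS2 => p h1 h2.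
have [p0|p0] := ltP 0 p.1; last first.
  rewrite /trace /window_weight ltNge p0 /= mul0r.
  by under eq_cvg do rewrite mul0r; exact: cvg_cst.
by apply: cvgM; [exact: cvg_cst|apply: H => //; rewrite lerDl ltW].
Qed.

(** Completing the square is what makes Fatou's lemma applicable: the field term is negative, but
    [energy_gap] integrates a nonnegative function. *)
Lemma energy_gap_minimizer : exists mu : {finite_measure set R -> \bar R},
  [/\ (mu setT <= 1)%E, L2 leb2 (tr mu) & forall nu, (nu setT <= 1)%E ->
    L2 leb2 (tr nu) -> energy_gap mu <= energy_gap nu].
Proof.
pose S := [set x : R | exists nu : {finite_measure set R -> \bar R},
  [/\ (nu setT <= 1)%E, L2 leb2 (tr nu) & energy_gap nu = x]].
have S0 : has_inf S.
  split; last by exists 0 => _ [nu [_ _ <-]]; exact: L2ip_ge0.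
  by exists (energy_gap sigma), sigma; split => //; exact: probability_le1.
have seq n : {nu : {finite_measure set R -> \bar R} | [/\ (nu setT <= 1)%E, L2 leb2 (tr nu)
    & energy_gap nu < inf S + n.+1%:R^-1]}.
  apply: cid; have e0 : 0 < n.+1%:R^-1 :> R by rewrite invr_gt0.
  by have [_ [nu [h1 h2 <-]] h3] := inf_adherent e0 S0; exists nu.
pose nu n := sval (seq n).
have nuP n : [/\ (nu n setT <= 1)%E, L2 leb2 (tr (nu n)) & energy_gap (nu n) < inf S + n.+1%:R^-1].
  exact: svalP (seq n).
have [|phi [mu [phi_infl mu1 cv]]] := @helly R nu; first by move=> n; case: (nuP n).
have mV nu' : measurable_fun setT (signed_trace nu').
  apply: measurable_funB; first exact: measurable_trace.
  by apply: measurable_funM => //; exact: measurable_trace.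
have I : (\int[leb2]_p (signed_trace mu p ^+ 2)%:E <= (inf S)%:E)%E.
  apply: (@fatou_cvg _ _ _ leb2 (fun n p => (signed_trace (nu (phi n)) p ^+ 2)%:E) _
    (fun n => inf S + n.+1%:R^-1)).
  - by move=> n; apply/measurable_EFinP; apply: measurable_funX.
  - by move=> n p; rewrite lee_fin sqr_ge0.
  - by apply/measurable_EFinP; apply: measurable_funX.
  - by move=> p; rewrite lee_fin sqr_ge0.
  - apply: filterS (@trace_ae_cvg (nu \o phi) mu cv) => p h.
    apply/fine_cvgP; split; first exact: nearW.
    apply: (@cvg_comp _ _ _ _ (fun x : R => x ^+ 2) _ _ _ _ (@sqr_continuous R _)).
    by apply: cvgB => //; exact: cvg_cst.
  - move=> n; have [_ h2 /ltW h3] := nuP (phi n).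
    rewrite -L2ipE ?lee_fin; last exact: L2_signed_trace.
    apply: (le_trans h3); rewrite lerD2l lef_pV2 ?posrE// ler_nat ltnS.
    exact: phi_infl.
  - rewrite -[X in _ --> X]addr0; apply: cvgD; first exact: cvg_cst.
    exact: cvg_harmonic.
have LV : L2 leb2 (signed_trace mu) by split => //; apply: le_lt_trans I _; exact: ltry.
(* Finite energy of the limit: its trace is the signed trace plus [q] times that of [sigma]. *)
have Lmu : L2 leb2 (tr mu).
  have := L2D LV (L2Z q L2_trace_sigma).
  by under eq_fun do rewrite subrK.
exists mu; split => // nu' h1 h2.
rewrite (@le_trans _ _ (inf S))//; last by apply: ge_inf; [case: S0|exists nu'].
by rewrite -lee_fin /energy_gap L2ipE.
Qed.

End weighted_energy.

(** * Frostman inequalities for the minimizer *)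

Section strict_integral.
Context d (T : measurableType d) (R : realType).
Variable mu : {measure set T -> \bar R}.

Lemma ge0_lt_integral (A : set T) (f g : T -> \bar R) : measurable A ->
  measurable_fun setT f -> measurable_fun setT g -> (forall x, (0 <= f x)%E) ->
  (forall x, A x -> (f x < g x)%E) -> (0 < mu A)%E ->
  (\int[mu]_(x in A) f x < +oo)%E ->
  (\int[mu]_(x in A) f x < \int[mu]_(x in A) g x)%E.
Proof.
move=> mA mf mg f0 fg muA fin.
have ffin x : A x -> f x \is a fin_num.
  by move=> /fg fgx; rewrite ge0_fin_numE// (lt_le_trans fgx)// leey.
have h0 x : A x -> (0 < g x - f x)%E by move=> Ax; rewrite sube_gt0 fg.
have mh : measurable_fun A (fun x => g x - f x)%E.
  by apply: emeasurable_funB; exact: measurable_funTS.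
have -> : (\int[mu]_(x in A) g x = \int[mu]_(x in A) (f x + (g x - f x)))%E.
  by apply: eq_integral => x; rewrite inE => Ax; rewrite addeC subeK// ffin.
rewrite ge0_integralD//; last 2 first.
- exact: measurable_funTS.
- by move=> x /h0/ltW.
rewrite -[ltLHS]adde0 lteD2lE//.
  exact: ge0_integral_gt0.
by rewrite ge0_fin_numE// integral_ge0.
Qed.

End strict_integral.

Section equilibrium.
Variables (R : realType) (s q a b : R).
Hypotheses (s_gt0 : 0 < s) (q_gt0 : 0 < q) (b_neq0 : b != 0).
Variable sigma : probability R R.
Local Notation N := (@dist_charge R a b).
Local Notation leb2 := (@leb2 R).
Local Notation tr := (@trace R s).
Local Notation ip := (L2ip leb2).
Local Notation gap := (@energy_gap R s q sigma).
Local Notation V := (@signed_trace R s q sigma).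
Implicit Types mu nu rho : {finite_measure set R -> \bar R}.

Hypothesis sigma_potential :
  forall x, (\int[sigma]_y riesz_kernel s x y = (N x `^ (- s))%:E)%E.

Let L2s : L2 leb2 (tr sigma).
Proof. exact: L2_trace_sigma sigma_potential. Qed.
Local Hint Resolve L2s : core.

Let L2V nu : L2 leb2 (tr nu) -> L2 leb2 (V nu).
Proof. exact: (L2_signed_trace q s_gt0 b_neq0 sigma_potential). Qed.
Local Hint Resolve L2V : core.

Lemma energy_gap_le0 nu : L2 leb2 (tr nu) -> gap nu <= 0 ->
  forall A, measurable A -> nu A = (q%:E * sigma A)%E.
Proof.
move=> h g0; apply: (trace_unique s_gt0); first exact: ltW.
by apply: filterS (L2ip_eq0 (L2V h) g0) => p /eqP; rewrite subr_eq0 => /eqP.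
Qed.

Lemma energy_gap_gt0 nu : L2 leb2 (tr nu) -> nu setT <> q%:E -> 0 < gap nu.
Proof.
move=> h nuq; rewrite ltNge; apply/negP => g0; apply: nuq.
by rewrite (energy_gap_le0 h g0)// [X in (_ * X)%E]probability_setT mule1.
Qed.

(** Along a segment the gap is quadratic in e: the linear coefficient gives the first variation, the
    quadratic one strict convexity. *)
Lemma energy_gap_expand mu nu rho (e : R) : L2 leb2 (tr mu) -> L2 leb2 (tr nu) ->
  tr rho = (fun p => (1 - e) * tr mu p + e * tr nu p) ->
  gap rho = gap mu + 2 * e * (ip (V mu) (tr nu) - ip (V mu) (tr mu))
      + e ^+ 2 * ip (fun p => tr nu p - tr mu p) (fun p => tr nu p - tr mu p).
Proof.
move=> Lm Ln trE; pose g p := tr nu p - tr mu p.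
have Lg : L2 leb2 g by exact: L2B.
have LV := L2V Lm.
have VE : V rho = (fun p => V mu p + e * g p).
  by apply/funext => p; rewrite /signed_trace trE /g; ring.
have Leg := L2Z e Lg.
have Veg h : L2 leb2 h -> ip (V rho) h = ip (V mu) h + e * ip g h.
  by move=> Lh; rewrite VE L2ipDl// L2ipZl.
have LVr : L2 leb2 (V rho) by rewrite VE; exact: L2D.
have gV : ip (V mu) g = ip (V mu) (tr nu) - ip (V mu) (tr mu).
  by rewrite L2ipC L2ipBl// ![ip _ (V mu)]L2ipC.
rewrite /energy_gap Veg// ![ip _ (V rho)]L2ipC !Veg// (L2ipC _ g (V mu)) gV.
ring.
Qed.

Section minimizer.
Variable mu : {finite_measure set R -> \bar R}.
Hypotheses (mu_le1 : (mu setT <= 1)%E) (L2mu : L2 leb2 (tr mu)).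
Hypothesis mu_min : forall nu, (nu setT <= 1)%E -> L2 leb2 (tr nu) -> gap mu <= gap nu.

Lemma minimizer_variation nu : (nu setT <= 1)%E -> L2 leb2 (tr nu) ->
  ip (V mu) (tr mu) <= ip (V mu) (tr nu).
Proof.
move=> nu1 Ln; rewrite -subr_ge0 leNgt; apply/negP.
set x := _ - _ => x0.
pose y := ip (fun p => tr nu p - tr mu p) (fun p => tr nu p - tr mu p).
have y0 : 0 <= y by exact: L2ip_ge0.
have yx0 : 0 < y - x by lra.
(* The increment of the gap is 2 e x + e^2 y with x < 0 <= y. Its minimizer - x / y may exceed 1 or
   fail to exist; with y - x in the denominator, e stays in ]0, 1] and the increment is e (x + e x)
   < 0. *)
pose e := - x / (y - x).
have e01 : 0 <= e <= 1.
  have xn : 0 <= - x by rewrite oppr_ge0 ltW.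
  by rewrite /e divr_ge0 ?(ltW yx0)//= ler_pdivrMr//; lra.
have /andP[e0 e1] := e01.
have [|rho rhoE] := @finite_measure_combination _ _ R mu nu (1 - e) e _ e0.
  by rewrite subr_ge0.
have trE := trace_combination s rhoE.
have gE := energy_gap_expand L2mu Ln trE.
have Lr : L2 leb2 (tr rho) by rewrite trE; apply: L2D; exact: L2Z.
have rho1 : (rho setT <= 1)%E.
  rewrite rhoE// -(finite_measure_fineK mu measurableT) -(finite_measure_fineK nu measurableT).
  move: mu_le1 nu1; rewrite -{1}(finite_measure_fineK mu measurableT) -{1}(finite_measure_fineK nu measurableT).
  by rewrite -!EFinM -EFinD !lee_fin => h1 h2; nra.
have := mu_min rho1 Lr; rewrite gE -/x -/y.
have egt0 : 0 < e by rewrite divr_gt0// oppr_gt0.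
have ee : e * (y - x) = - x by rewrite /e divfK// gt_eqF.
move=> h.
have h2 : 0 <= 2 * x + e * y by rewrite -(pmulr_rge0 _ egt0); move: h; rewrite expr2; lra.
have h3 : e * y = - x + e * x by move: ee; rewrite mulrBr => /eqP; rewrite subr_eq => /eqP ->; ring.
have : e * x <= 0 by rewrite mulr_ge0_le0 ?ltW.
move: h2; rewrite h3; lra.
Qed.

(** The expansion at e = 1 has a nonnegative linear term, so the squared norm of the difference of
    traces must be 0. *)
Lemma minimizer_strict nu : (nu setT <= 1)%E -> L2 leb2 (tr nu) -> gap nu <= gap mu ->
  forall A, measurable A -> nu A = mu A.
Proof.
move=> nu1 Ln gnm.
have trE : tr nu = (fun p => (1 - 1) * tr mu p + 1 * tr nu p).
  by apply/funext => p; ring.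
have gE := energy_gap_expand L2mu Ln trE.
have := minimizer_variation nu1 Ln => hv.
have g0 : ip (fun p => tr nu p - tr mu p) (fun p => tr nu p - tr mu p) <= 0.
  by move: gE gnm; rewrite expr1n; lra.
move=> A mA; rewrite -[RHS]mul1e; apply: (trace_unique s_gt0) => //.
apply: filterS (L2ip_eq0 (L2B Ln L2mu) g0) => p /eqP.
by rewrite subr_eq0 mul1r => /eqP.
Qed.

(** The Frostman constant: the [mu]-integral of the potential of [mu] minus q |x - z|^(-s). *)
Let F := ip (V mu) (tr mu).

(** The zero measure, admissible in the relaxed problem, gives [F] <= 0. If [F] = 0, the variation
    towards [sigma] makes the gap, equal to [F] minus [q] times a nonnegative number,
    nonpositive. *)
Let F_lt0 : mu setT <> q%:E -> F < 0.
Proof.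
move=> muq; have gp := energy_gap_gt0 L2mu muq.
have F0 : F <= 0.
  pose z : {finite_measure set R -> \bar R} := mzero.
  have zE : tr z = (fun p => 0 * tr mu p) by apply/funext => p; rewrite /trace /= mul0r mulr0.
  have := @minimizer_variation z; rewrite zE => /(_ _ (L2Z 0 L2mu)).
  have -> : ip (V mu) (fun p => 0 * tr mu p) = 0.
    by rewrite L2ipC L2ipZl ?mul0r//; exact: L2V.
  by apply; rewrite /= /mzero lee_fin.
rewrite lt_neqAle F0 andbT; apply/eqP => FE.
have := minimizer_variation (probability_le1 sigma measurableT) L2s.
rewrite -/F FE => h.
have : gap mu = F - q * ip (V mu) (tr sigma).
  rewrite /energy_gap {1}/signed_trace L2ipBl//; [|exact: L2Z|exact: L2V].
  rewrite L2ipZl//; last exact: L2V.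
  by rewrite (L2ipC _ (tr mu)) (L2ipC _ (tr sigma)).
rewrite FE => gE; move: gp; rewrite gE sub0r oppr_gt0 pmulr_rlt0//.
by rewrite ltNge h.
Qed.

(* If mass were missing, moving towards [q sigma] (mass [q > 1]) would stay
   admissible and contract the signed trace. *)
Lemma minimizer_mass : 1 < q -> mu setT = 1%E.
Proof.
move=> q1; pose m := fine (mu setT).
have mE : mu setT = m%:E by rewrite /m finite_measure_fineK.
have m1 : m <= 1 by rewrite -lee_fin -mE.
have gp : 0 < gap mu.
  by apply: energy_gap_gt0 => //; rewrite mE => -[mq]; move: q1; rewrite -mq ltNge m1.
rewrite mE; congr EFin; apply/eqP; rewrite eq_le m1 leNgt; apply/negP => mlt.
have qm : 0 < q - m by lra.
(* The solution of (1 - e) m + e q = 1: the competitor has mass exactly 1. *)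
pose e := (1 - m) / (q - m).
have e0 : 0 < e by rewrite divr_gt0// subr_gt0.
have e1 : e < 1 by rewrite ltr_pdivrMr//; lra.
have ee : e * (q - m) = 1 - m by rewrite divfK// gt_eqF.
have eq0 : 0 <= e * q by rewrite mulr_ge0 ?ltW.
have [|rho rhoE] := @finite_measure_combination _ _ R mu sigma (1 - e) (e * q) _ eq0.
  by rewrite subr_ge0 ltW.
have trE := trace_combination s rhoE.
have Lr : L2 leb2 (tr rho) by rewrite trE; apply: L2D; exact: L2Z.
have VE : V rho = (fun p => (1 - e) * V mu p).
  by apply/funext => p; rewrite /signed_trace trE; ring.
have := mu_min _ Lr; rewrite {2}/energy_gap VE L2ipZl//; [|exact: L2V|apply: L2Z; exact: L2V].
rewrite L2ipC L2ipZl//; [|exact: L2V|exact: L2V].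
rewrite -/(gap mu) => /(_ _)/wrap[].
  rewrite rhoE// mE [X in (_ + _ * X)%E](probability_setT sigma) mule1 -EFinM -EFinD lee_fin.
  by move: ee; rewrite mulrBr; lra.
move=> h; have : gap mu * (1 - (1 - e) * (1 - e)) <= 0 by lra.
rewrite pmulr_rle0// leNgt => /negP; apply; nra.
Qed.

Section frostman.
Hypothesis q_gt1 : 1 < q.
Let c := - F.
Local Notation U := (potential s mu).

Let muT : mu setT = 1%E. Proof. exact: minimizer_mass. Qed.

Lemma frostman_constant_gt0 : 0 < c.
Proof.
by rewrite oppr_gt0 F_lt0// muT => -[q1]; move: q_gt1; rewrite -q1 ltxx.
Qed.

Let mU : measurable_fun setT U. Proof. exact: measurable_potential. Qed.
Let U0 x : (0 <= U x)%E. Proof. exact: potential_ge0. Qed.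

Let mN : measurable_fun setT (fun x => (N x `^ (- s))%:E).
Proof. exact: measurable_charge_potential. Qed.

Let qN_integral rho : (\int[rho]_x (q * N x `^ (- s))%:E =
  q%:E * \int[rho]_x (N x `^ (- s))%:E)%E.
Proof.
under eq_integral do rewrite EFinM.
apply: ge0_integralZl => //; last by rewrite lee_fin ltW.
by move=> x _; rewrite lee_fin powR_ge0.
Qed.

Let qN_ip rho : L2 leb2 (tr rho) ->
  (\int[rho]_x (q * N x `^ (- s))%:E = (q * ip (tr rho) (tr sigma))%:E)%E.
Proof.
move=> Lr; rewrite qN_integral EFinM.
by rewrite (integral_charge_potential s_gt0 b_neq0 sigma_potential Lr).
Qed.

(** The first variation at [rho] divided by its mass, multiplied back; a [rho] of zero mass is
    treated apart. Every finite-energy measure thus serves as a test. *)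
Let test rho : L2 leb2 (tr rho) ->
  q * ip (tr rho) (tr sigma) <= ip (tr rho) (tr mu) + c * fine (rho setT).
Proof.
move=> Lr; pose m := fine (rho setT); have m0 : 0 <= m by exact: fine_ge0.
have trV k : L2 leb2 (fun p => k * tr rho p) ->
    ip (V mu) (fun p => k * tr rho p) = k * (ip (tr rho) (tr mu) - q * ip (tr rho) (tr sigma)).
  move=> Lk; rewrite L2ipC L2ipZl//; last exact: L2V.
  by rewrite (L2ipC _ _ (V mu)) (signed_ipE q s_gt0 b_neq0 sigma_potential).
have [m00|mn0] := eqVneq m 0.
  have rho0 A : measurable A -> rho A = 0%E.
    move=> mA; apply/eqP; rewrite eq_le measure_ge0 andbT.
    have <- : rho setT = 0%E by rewrite -(finite_measure_fineK rho measurableT) -/m m00.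
    by rewrite le_measure ?inE.
  have z0 nu : L2 leb2 (tr nu) -> ip (tr rho) (tr nu) = 0.
    move=> Ln; transitivity (ip (fun p => 0 * tr rho p) (tr nu)).
      congr L2ip; apply/funext => p; rewrite mul0r /trace rho0 ?mulr0//.
    by rewrite L2ipZl// mul0r.
  by rewrite !z0// rho0//= !mulr0 addr0.
have mgt0 : 0 < m by rewrite lt_neqAle eq_sym mn0.
have [|nu nuE] := @finite_measure_combination _ _ R rho rho m^-1 0 _ (lexx 0).
  by rewrite invr_ge0.
have trE : tr nu = (fun p => m^-1 * tr rho p).
  by rewrite (trace_combination s nuE); apply/funext => p; ring.
have Ln : L2 leb2 (tr nu) by rewrite trE; exact: L2Z.
have nu1 : (nu setT <= 1)%E.
  rewrite nuE// mul0e adde0 -(finite_measure_fineK rho measurableT) -/m.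
  by rewrite -EFinM mulVf.
have := minimizer_variation nu1 Ln; rewrite trE trV; last exact: L2Z.
rewrite -/F ler_pdivlMl// -/m /c; lra.
Qed.

Let test_set rho A : measurable A -> L2 leb2 (tr rho) ->
  (\int[rho]_(x in A) (q * N x `^ (- s))%:E <= \int[rho]_(x in A) (U x + c%:E))%E.
Proof.
move=> mA Lr; have [nu [nuE nuI]] := finite_measure_restriction rho mA.
have Ln : L2 leb2 (tr nu).
  apply: (L2_trace_le _ Lr) => B mB; rewrite nuE//.
  by rewrite le_measure ?inE//; exact: measurableI.
have mq : measurable_fun setT (fun x => (q * N x `^ (- s))%:E).
  apply/measurable_EFinP; apply: measurable_funM => //.
  exact: measurable_dist_charge_powR.
have q0 x : (0 <= (q * N x `^ (- s))%:E)%E by rewrite lee_fin mulr_ge0 ?powR_ge0// ltW.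
have c0 := frostman_constant_gt0.
rewrite -!nuI//; last 2 first.
- exact: emeasurable_funD.
- by move=> x; rewrite adde_ge0// lee_fin ltW.
rewrite ge0_integralD//; last by move=> x _; rewrite lee_fin ltW.
rewrite (integral_potential s_gt0 L2mu Ln).
rewrite (qN_ip Ln).
rewrite [X in (_ <= _ + X)%E](_ : _ = (c * fine (nu setT))%:E); last first.
  by rewrite integral_cst// EFinM finite_measure_fineK.
by rewrite -EFinD lee_fin; exact: test.
Qed.

Let mD : measurable_fun setT (fun x => U x + c%:E)%E.
Proof. exact: emeasurable_funD. Qed.

Let D0 x : (0 <= U x + c%:E)%E.
Proof. by rewrite adde_ge0// lee_fin ltW// frostman_constant_gt0. Qed.

Let mq : measurable_fun setT (fun x => (q * N x `^ (- s))%:E).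
Proof.
apply/measurable_EFinP; apply: measurable_funM => //.
exact: measurable_dist_charge_powR.
Qed.

Let q0 x : (0 <= (q * N x `^ (- s))%:E)%E.
Proof. by rewrite lee_fin mulr_ge0 ?powR_ge0// ltW. Qed.

Let q_fin rho A : measurable A -> (\int[rho]_(x in A) (q * N x `^ (- s))%:E < +oo)%E.
Proof.
move=> mA; apply: (@le_lt_trans _ _ (\int[rho]_x (q * N x `^ (- s))%:E)%E).
  by apply: ge0_subset_integral.
rewrite qN_integral lte_mul_pinfty ?lee_fin ?(ltW q_gt0)//.
exact: integral_charge_fin.
Qed.

(** If the opposite strict inequality held throughout [A], integrating it against the restriction of
    [sigma] to [A] would contradict [test_set]. *)
Lemma frostman_ge A : measurable A -> (0 < sigma A)%E ->
  exists2 x, A x & ((q * N x `^ (- s))%:E <= U x + c%:E)%E.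
Proof.
move=> mA sA; apply: contrapT => h.
have lt x : A x -> (U x + c%:E < (q * N x `^ (- s))%:E)%E.
  by move=> Ax; rewrite ltNge; apply/negP => hx; apply: h; exists x.
have fin : (\int[sigma]_(x in A) (U x + c%:E) < +oo)%E.
  apply: le_lt_trans (q_fin sigma mA); apply: ge0_le_integral => //.
  - exact: measurable_funTS.
  - exact: measurable_funTS.
  - by move=> x /lt/ltW.
have := ge0_lt_integral mA mD mq D0 lt sA fin.
by rewrite ltNge test_set.
Qed.

(** Against [mu] itself the inequality of [test_set] is an equality on the whole line, by the choice
    of [c]. A strict excess on [A] cannot be compensated on the complement, where [test_set] holds
    as well. *)
Lemma frostman_le A : measurable A -> (0 < mu A)%E ->
  exists2 x, A x & (U x + c%:E <= (q * N x `^ (- s))%:E)%E.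
Proof.
move=> mA sA; apply: contrapT => h.
have lt x : A x -> ((q * N x `^ (- s))%:E < U x + c%:E)%E.
  by move=> Ax; rewrite ltNge; apply/negP => hx; apply: h; exists x.
have l1 := ge0_lt_integral mA mq mD q0 lt sA (q_fin mu mA).
have mAC : measurable (~` A) by exact: measurableC.
have l2 := test_set mAC L2mu.
have spl (f : R -> \bar R) : measurable_fun setT f -> (forall x, (0 <= f x)%E) ->
    (\int[mu]_x f x = \int[mu]_(x in A) f x + \int[mu]_(x in ~` A) f x)%E.
  move=> mf f0; rewrite -(setUv A) ge0_integral_setU//; first by rewrite setUv.
  by apply/disj_setPS; rewrite setICr.
have total : (\int[mu]_x (U x + c%:E) = \int[mu]_x (q * N x `^ (- s))%:E)%E.
  rewrite ge0_integralD//; last by move=> x _; rewrite lee_fin ltW// frostman_constant_gt0.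
  rewrite (integral_potential s_gt0 L2mu L2mu).
  rewrite (qN_ip L2mu) integral_cst//= [X in (_ * X)%E]muT mule1 -EFinD; congr EFin.
  by rewrite /c /F (signed_ipE q s_gt0 b_neq0 sigma_potential)// opprB addrC subrK.
have : (\int[mu]_x (q * N x `^ (- s))%:E < \int[mu]_x (U x + c%:E))%E.
  rewrite (spl _ mq q0) (spl _ mD D0) lte_leD//.
  by rewrite ge0_fin_numE ?integral_ge0// q_fin.
by rewrite total ltxx.
Qed.

Lemma potential_integrable : (\int[mu]_x U x < +oo)%E.
Proof. by rewrite (integral_potential s_gt0 L2mu L2mu) ltry. Qed.

End frostman.
End minimizer.
End equilibrium.

(** * The support is an interval *)

Section support_interval.
Variables (R : realType) (s q a b c : R).
Hypotheses (s_gt0 : 0 < s) (q_gt0 : 0 < q) (b_neq0 : b != 0) (c_gt0 : 0 < c).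
Local Notation N := (@dist_charge R a b).
Variable mu : {finite_measure set R -> \bar R}.
Local Notation U := (potential s mu).
Hypotheses (muT : mu setT = 1%E) (U_fin : (\int[mu]_x U x < +oo)%E).
Hypothesis frostman_le : forall A, measurable A -> (0 < mu A)%E ->
  exists2 x, A x & (U x + c%:E <= (q * N x `^ (- s))%:E)%E.
Hypothesis frostman_ge : forall u v : R, u < v ->
  exists2 x, u < x < v & ((q * N x `^ (- s))%:E <= U x + c%:E)%E.

Let S : set R := [set x | forall e : R, 0 < e -> (0 < mu `](x - e)%R, (x + e)%R[%classic)%E].

Let N_gt0 x : 0 < N x. Proof. exact: dist_charge_gt0. Qed.

Let mU : measurable_fun setT U. Proof. exact: measurable_potential. Qed.

(** An atom makes the potential infinite at [x], and then the energy infinite. *)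
Lemma finite_energy_not_atom x : mu [set x] = 0%E.
Proof.
apply/eqP; rewrite eq_le measure_ge0 andbT leNgt; apply/negP => mux.
have Ux : U x = +oo%E.
  apply/eqP; rewrite -leye_eq; apply: (@le_trans _ _ (\int[mu]_(y in [set x]) riesz_kernel s x y)%E).
    rewrite (eq_integral (cst +oo%E)); last by move=> y; rewrite inE /= => ->; rewrite /riesz_kernel eqxx.
    by rewrite integral_cst// gt0_mulye.
  apply: ge0_subset_integral => //; first exact: measurable_riesz_kernel1.
  by move=> y _; exact: riesz_kernel_ge0.
move: U_fin; rewrite ltNge => /negP; apply.
apply: (@le_trans _ _ (\int[mu]_(y in [set x]) U y)%E).
  rewrite (eq_integral (cst +oo%E)); last by move=> y; rewrite inE /= => ->.
  by rewrite integral_cst// gt0_mulye.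
by apply: ge0_subset_integral => // y _; exact: potential_ge0.
Qed.

(** Every neighbourhood of a support point contains points where the inequality holds. It passes to
    the limit since the field is continuous and, by Fatou, the potential is lower semicontinuous;
    the kernels converge off {x}, which is [mu]-null. *)
Let le_on_support x : S x -> (U x + c%:E <= (q * N x `^ (- s))%:E)%E.
Proof.
move=> Sx.
have pt n : {y : R | `|y - x| < n.+1%:R^-1 /\ (U y + c%:E <= (q * N y `^ (- s))%:E)%E}.
  apply: cid; have e0 : 0 < n.+1%:R^-1 :> R by rewrite invr_gt0.
  have [y] := frostman_le (measurable_itv _) (Sx _ e0).
  rewrite /= in_itv/= => h1 h2; exists y; split => //.
  by move: h1; set e := _^-1 => h1; rewrite ltr_norml; lra.
pose z n := sval (pt n).
have zP n : `|z n - x| < n.+1%:R^-1 /\ (U (z n) + c%:E <= (q * N (z n) `^ (- s))%:E)%E.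
  exact: svalP (pt n).
have zx : z n @[n --> \oo] --> x.
  apply/cvgrPdist_le => e e0; have := @cvg_harmonic R => /cvgrPdist_le/(_ e e0).
  apply: filterS => n; rewrite sub0r normrN ger0_norm ?invr_ge0// => h.
  by rewrite distrC; exact: le_trans (ltW (zP n).1) h.
have Nc : continuous (fun y => q * N y `^ (- s) - c).
  move=> y; apply: cvgB; last exact: cvg_cst.
  by apply: cvgM; [exact: cvg_cst|exact: continuous_dist_charge_powR].
suff : (U x <= (q * N x `^ (- s) - c)%:E)%E by rewrite EFinB leeBrDr.
apply: (@fatou_cvg _ _ _ mu (fun n y => riesz_kernel s (z n) y) _ (fun n => q * N (z n) `^ (- s) - c)).
- by move=> n; exact: measurable_riesz_kernel1.
- by move=> n y; exact: riesz_kernel_ge0.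
- exact: measurable_riesz_kernel1.
- by move=> y; exact: riesz_kernel_ge0.
- exists [set x]; split => //; first exact: finite_energy_not_atom.
  move=> y /= h; apply: contrapT => /eqP yx; apply: h.
  have xy : x != y by rewrite eq_sym.
  rewrite /riesz_kernel (negbTE xy).
  have nz : \forall n \near \oo, z n != y.
    exact: (zx _ (open_nbhs_nbhs (conj (@open_neq R y) xy))).
  apply: (@cvg_trans _ ((`|z n - y| `^ (- s))%:E @[n --> \oo])).
    by apply: near_eq_cvg; apply: filterS nz => n /negbTE ->.
  apply/fine_cvgP; split; first exact: nearW.
  apply: (@cvg_comp _ _ _ z (fun w => `|w - y| `^ (- s)) _ (nbhs x)) => //.
  apply: (@continuous_comp _ _ _ (fun w : R => `|w - y|) (@powR R ^~ (- s))).
    apply: (@continuous_comp _ _ _ (fun w : R => w - y) (fun w => `|w|)).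
      by apply: cvgB => //; exact: cvg_cst.
    exact: norm_continuous.
  by apply: continuous_powR; rewrite normr_gt0 subr_eq0.
- by move=> n; have [_] := zP n; rewrite EFinB leeBrDr.
- exact: (@cvg_comp _ _ _ z (fun y => q * N y `^ (- s) - c) _ (nbhs x) _ zx (Nc x)).
Qed.

(* the tangent of [t^(-s)] at [t = 1], applied at [u / w] and [v / w] where
   [w] is the weighted mean *)
Lemma powRN_convex (l u v : R) : 0 <= l <= 1 -> 0 < u -> 0 < v ->
  (l * u + (1 - l) * v) `^ (- s) <= l * u `^ (- s) + (1 - l) * v `^ (- s).
Proof.
move=> /andP[l0 l1] u0 v0; set w := l * u + (1 - l) * v.
have w0 : 0 < w.
  rewrite /w; have [->|ln0] := eqVneq l 0; first by rewrite mul0r subr0 mul1r add0r.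
  by rewrite ltr_pwDl ?mulr_gt0 ?mulr_ge0 ?(ltW v0) ?subr_ge0// lt_neqAle eq_sym ln0.
have tangent t : 0 < t -> w `^ (- s) * (1 - s * (t / w - 1)) <= t `^ (- s).
  move=> t0; have tw : 0 < t / w by rewrite divr_gt0.
  have -> : t `^ (- s) = w `^ (- s) * (t / w) `^ (- s).
    by rewrite -powRM ?ltW// mulrC divfK// gt_eqF.
  rewrite ler_pM2l ?powR_gt0// /powR (gt_eqF tw).
  apply: le_trans (expR_ge1Dx _); rewrite lerD2l mulNr lerN2 ler_pM2l//.
  by have := expR_ge1Dx (ln (t / w)); rewrite lnK ?posrE//; lra.
have hu := ler_wpM2l l0 (tangent u u0).
have l10 : 0 <= 1 - l by rewrite subr_ge0.
have hv := ler_wpM2l l10 (tangent v v0).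
apply: le_trans (lerD hu hv).
rewrite le_eqVlt; apply/orP; left; apply/eqP.
have -> : l * (w `^ (- s) * (1 - s * (u / w - 1))) + (1 - l) * (w `^ (- s) * (1 - s * (v / w - 1)))
  = w `^ (- s) * (1 - s * ((l * u + (1 - l) * v) / w - 1)) by ring.
by rewrite -/w divff ?gt_eqF// subrr mulr0 subr0 mulr1.
Qed.

Let le_pinfty_combination (x1 x2 : R) (k k' : \bar R) : 0 < x1 -> 0 < x2 ->
  (0 <= k')%E -> (k <= x1%:E * +oo + x2%:E * k')%E.
Proof.
move=> x10 x20 k0; rewrite gt0_muley ?lte_fin// addye ?leey// -ltNye.
by apply: (@lt_le_trans _ _ 0%E) => //; rewrite mule_ge0// lee_fin ltW.
Qed.

(* Inside a gap []al, be[] of the support, the potential at [x] is dominated by a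
   combination of those at the endpoints, with weights chosen so that the same
   combination interpolates the field strictly. *)
Let gap_lt al be x : al < x < be -> mu `]al, be[%classic = 0%E ->
  (U al + c%:E <= (q * N al `^ (- s))%:E)%E ->
  (U be + c%:E <= (q * N be `^ (- s))%:E)%E ->
  (U x + c%:E < (q * N x `^ (- s))%:E)%E.
Proof.
move=> /andP[alx xbe] mu0 Dal Dbe.
pose t := (x - al) / (be - al).
have ab0 : 0 < be - al by lra.
have t0 : 0 < t by rewrite divr_gt0// subr_gt0.
have t1 : t < 1 by rewrite ltr_pdivrMr//; lra.
have xE : x = (1 - t) * al + t * be.
  have : t * (be - al) = x - al by rewrite divfK// gt_eqF.
  have -> : (1 - t) * al + t * be = al + t * (be - al) by ring.
  by move=> ->; ring.
have t10 : 0 < 1 - t by rewrite subr_gt0.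
set Na := N al; set Nb := N be.
have Na0 : 0 < Na by exact: N_gt0.
have Nb0 : 0 < Nb by exact: N_gt0.
pose M := (1 - t) * Na + t * Nb.
have M0 : 0 < M by rewrite addr_gt0// mulr_gt0.
(* Plain weights 1 - t and t would give the bound (1 - t) Na^(-s) + t Nb^(-s), which need not lie
   below N x^(-s). Dividing every distance by the distance to the charge first gives the exact value
   M^(-s) instead. *)
pose l := (1 - t) * Na / M.
have l1E : 1 - l = t * Nb / M.
  by apply: (mulIf (lt0r_neq0 M0)); rewrite mulrBl mul1r /l !divfK ?gt_eqF// /M; ring.
have l0 : 0 < l by rewrite !divr_gt0 ?mulr_gt0.
have l10 : 0 < 1 - l by rewrite l1E divr_gt0// mulr_gt0.
have l01 : 0 <= l <= 1 by rewrite ltW//= -subr_ge0 ltW.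
have NM : N x < M.
  have NaE : Na ^+ 2 = (al - a) ^+ 2 + b ^+ 2 by exact: dist_charge_sqr.
  have NbE : Nb ^+ 2 = (be - a) ^+ 2 + b ^+ 2 by exact: dist_charge_sqr.
  pose X := (al - a) * (be - a) + b ^+ 2.
  (* Cauchy-Schwarz for the vectors from the charge to the endpoints, strict because b <> 0 and al <
     be: the defect is b^2 (be - al)^2. *)
  have XN : X < Na * Nb.
    rewrite ltNge; apply/negP => h.
    have NN0 : 0 <= Na * Nb by rewrite mulr_ge0 ?ltW.
    have : (Na * Nb) ^+ 2 <= X ^+ 2 by rewrite ler_sqr ?nnegrE ?(le_trans NN0).
    have -> : (Na * Nb) ^+ 2 = X ^+ 2 + b ^+ 2 * (be - al) ^+ 2.
      by rewrite exprMn NaE NbE /X; ring.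
    have b2 : 0 < b ^+ 2 by rewrite exprn_even_gt0.
    by rewrite gerDl leNgt mulr_gt0// exprn_gt0.
  rewrite -ltr_sqr ?nnegrE ?(ltW M0) ?(ltW (N_gt0 _))//.
  have -> : M ^+ 2 = (1 - t) ^+ 2 * Na ^+ 2 + t ^+ 2 * Nb ^+ 2 + 2 * t * (1 - t) * (Na * Nb).
    by rewrite /M; ring.
  have h : 0 < 2 * t * (1 - t) * (Na * Nb - X).
    have XN' : 0 < Na * Nb - X by rewrite subr_gt0.
    by do 2 (apply: mulr_gt0 => //); apply: mulr_gt0.
  rewrite NaE NbE dist_charge_sqr {1}xE -subr_gt0; move: h; congr (_ < _).
  by rewrite /X; ring.
have [A1 A1E] : {A1 | A1 = M `^ (- s) * (l * Na `^ s)} by eexists.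
have [A2 A2E] : {A2 | A2 = M `^ (- s) * ((1 - l) * Nb `^ s)} by eexists.
have A10 : 0 < A1 by rewrite A1E; apply: mulr_gt0; [|apply: mulr_gt0]; rewrite ?powR_gt0.
have A20 : 0 < A2 by rewrite A2E; apply: mulr_gt0; [|apply: mulr_gt0]; rewrite ?powR_gt0.
have powV y : 0 < y -> (y^-1) `^ (- s) = y `^ s.
  by move=> y0; rewrite -powR_inv1 ?ltW// -powRrM mulN1r opprK.
(* convexity read at the point at infinity *)
have A12 : 1 <= A1 + A2.
  have := powRN_convex l01 (_ : 0 < Na^-1) (_ : 0 < Nb^-1).
  rewrite !invr_gt0 => /(_ Na0 Nb0).
  have -> : l * Na^-1 + (1 - l) * Nb^-1 = M^-1.
    by rewrite l1E /l; field; rewrite !gt_eqF.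
  rewrite !powV// => h.
  have -> : A1 + A2 = M `^ (- s) * (l * Na `^ s + (1 - l) * Nb `^ s) by rewrite A1E A2E; ring.
  by rewrite powRN ler_pdivlMl ?powR_gt0// mulr1.
have ker T : ~ (al < T < be) -> (riesz_kernel s x T <=
    A1%:E * riesz_kernel s al T + A2%:E * riesz_kernel s be T)%E.
  move=> T0; have k0 y := riesz_kernel_ge0 s y T.
  have [Tal|Tal] := eqVneq T al.
    move: (k0 be); rewrite Tal.
    by rewrite [riesz_kernel s al al]/riesz_kernel eqxx; exact: le_pinfty_combination.
  have [Tbe|Tbe] := eqVneq T be.
    move: (k0 al); rewrite Tbe.
    by rewrite [riesz_kernel s be be]/riesz_kernel eqxx addeC; exact: le_pinfty_combination.
  have Tx : x != T by apply/eqP => xT; apply: T0; rewrite -xT alx.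
  rewrite /riesz_kernel (negbTE Tx) ![_ == T]eq_sym (negbTE Tal) (negbTE Tbe).
  rewrite -!EFinM -EFinD lee_fin.
  have d1 : 0 < `|al - T| by rewrite normr_gt0 subr_eq0 eq_sym.
  have d2 : 0 < `|be - T| by rewrite normr_gt0 subr_eq0 eq_sym.
  (* Outside the gap [T] lies on one side of [al], [x] and [be], so the distance to it is affine
     between them. *)
  have xTE : `|x - T| = (1 - t) * `|al - T| + t * `|be - T|.
    have [Tl|lT] := leP T al.
      by rewrite !ger0_norm ?subr_ge0; [rewrite {1}xE; ring|lra|lra|lra].
    have bT : be <= T by rewrite leNgt; apply/negP => Tb; apply: T0; rewrite lT.
    by rewrite !ler0_norm ?subr_le0; [rewrite {1}xE; ring|lra|lra|lra].
  have -> : `|x - T| = M * (l * (`|al - T| / Na) + (1 - l) * (`|be - T| / Nb)).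
    by rewrite xTE l1E /l; field; rewrite !gt_eqF.
  have u0 : 0 < `|al - T| / Na by rewrite divr_gt0.
  have v0 : 0 < `|be - T| / Nb by rewrite divr_gt0.
  have w0 : 0 <= l * (`|al - T| / Na) + (1 - l) * (`|be - T| / Nb).
    by rewrite addr_ge0//; apply: mulr_ge0; exact: ltW.
  have Nai : 0 <= Na^-1 by rewrite invr_ge0 ltW.
  have Nbi : 0 <= Nb^-1 by rewrite invr_ge0 ltW.
  rewrite (powRM _ (ltW M0) w0).
  have := powRN_convex l01 u0 v0.
  rewrite (powRM _ (ltW d1) Nai) (powRM _ (ltW d2) Nbi) !powV// => h.
  have -> : A1 * `|al - T| `^ (- s) + A2 * `|be - T| `^ (- s) =
    M `^ (- s) * (l * (`|al - T| `^ (- s) * Na `^ s) + (1 - l) * (`|be - T| `^ (- s) * Nb `^ s)).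
    by rewrite A1E A2E; ring.
  by rewrite ler_pM2l ?powR_gt0.
have mk y := measurable_riesz_kernel1 s y.
have Uint : (U x <= A1%:E * U al + A2%:E * U be)%E.
  have A1n : 0 <= A1 by exact: ltW.
  have A2n : 0 <= A2 by exact: ltW.
  have Zl y A : 0 <= A -> (A%:E * potential s mu y = \int[mu]_z (A%:E * riesz_kernel s y z))%E.
    move=> A0; rewrite -ge0_integralZl// => z _; exact: riesz_kernel_ge0.
  rewrite (Zl al)// (Zl be)//.
  rewrite -ge0_integralD//; first last.
  - exact: measurable_funeM.
  - by move=> y _; rewrite mule_ge0 ?lee_fin ?(ltW A20)//; exact: riesz_kernel_ge0.
  - exact: measurable_funeM.
  - by move=> y _; rewrite mule_ge0 ?lee_fin ?(ltW A10)//; exact: riesz_kernel_ge0.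
  apply: ae_ge0_le_integral => //.
  - by move=> y _; exact: riesz_kernel_ge0.
  - by move=> y _; rewrite adde_ge0// mule_ge0 ?lee_fin ?(ltW A20) ?(ltW A10)//; exact: riesz_kernel_ge0.
  - by apply: emeasurable_funD; exact: measurable_funeM.
  - exists `]al, be[%classic; split => // y /= h; rewrite in_itv/=.
    by apply: contrapT => y0; apply: h => _; exact: ker.
have Ufin y : (U y + c%:E <= (q * N y `^ (- s))%:E)%E -> exists2 r, U y = r%:E & r <= q * N y `^ (- s) - c.
  have := potential_ge0 s mu y; case: (U y) => [r| |]// _; rewrite -EFinD lee_fin => h.
  by exists r => //; lra.
have [ra Ua ha] := Ufin _ Dal; have [rb Ub hb] := Ufin _ Dbe.
apply: (@le_lt_trans _ _ ((A1 * ra + A2 * rb + c)%:E)).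
  by rewrite EFinD leeD2r// (le_trans Uint)// Ua Ub.
rewrite lte_fin.
have h1 : A1 * ra + A2 * rb <= A1 * (q * Na `^ (- s) - c) + A2 * (q * Nb `^ (- s) - c).
  by rewrite lerD ?ler_pM2l.
have h2 : A1 * Na `^ (- s) + A2 * Nb `^ (- s) = M `^ (- s).
  rewrite A1E A2E !powRN; field; rewrite !gt_eqF ?powR_gt0//.
have h3 : M `^ (- s) < N x `^ (- s).
  rewrite !powRN ltf_pV2 ?posrE ?powR_gt0//.
  by apply: gt0_ltr_powR; rewrite // nnegrE ltW.
have h4 : q * M `^ (- s) < q * N x `^ (- s) by rewrite ltr_pM2l.
(* Here the sign of [c] enters: the combination carries - c (A1 + A2) where only - c is required. *)
have h5 : 0 <= c * (A1 + A2 - 1) by rewrite mulr_ge0 ?subr_ge0// ltW.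
move: h1 h4 h5; rewrite -h2; set x1 := Na `^ _; set x2 := Nb `^ _.
by set y := q * N x `^ _; lra.
Qed.

Let not_support x : ~ S x -> exists2 e : R, 0 < e & mu `]x - e, x + e[%classic = 0%E.
Proof.
move=> /existsNP[e /not_implyP[e0 /negP]]; rewrite -leNgt => h; exists e => //.
by apply/eqP; rewrite eq_le h measure_ge0.
Qed.

Let null_sub (A B : set R) : measurable A -> measurable B -> A `<=` B -> mu B = 0%E -> mu A = 0%E.
Proof.
move=> mA mB AB B0; apply/eqP; rewrite eq_le measure_ge0 andbT -B0.
by rewrite le_measure ?inE.
Qed.

Let not_support_nbhd x : ~ S x -> exists2 e : R, 0 < e & forall y, `|y - x| < e -> ~ S y.
Proof.
move=> /not_support[e e0 h]; exists e => // y yx Sy.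
have e'0 : 0 < e - `|y - x| by rewrite subr_gt0.
have := Sy _ e'0; rewrite (null_sub _ _ _ h) ?ltxx// => z /=.
rewrite !in_itv/= => /andP[h1 h2]; have := ler_norm (y - x); have := ler_norm (- (y - x)).
by rewrite normrN => h3 h4; apply/andP; split; lra.
Qed.

(** The supremum of the w for which ]u, w] is null is a support point: otherwise a null
    neighbourhood would extend the null interval beyond it. *)
Let support_between u v : (0 < mu `]u, v]%classic)%E -> exists2 x, S x & u <= x <= v.
Proof.
move=> muv; have uv : u < v.
  rewrite ltNge; apply/negP => vu; move: muv.
  by rewrite set_itv_ge ?bnd_simp -?leNgt// measure0 ltxx.
pose W := [set w : R | u <= w <= v /\ mu `]u, w]%classic = 0%E].
have Wu : W u.
  by split; [rewrite lexx ltW|rewrite set_itv_ge ?bnd_simp ?ltxx// measure0].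
have hW : has_sup W by split; [exists u|exists v => w [/andP[]]].
have ux : u <= sup W by exact: (sup_upper_bound hW).
have xv : sup W <= v by apply: ge_sup; [exists u|move=> w [/andP[]]].
exists (sup W); last by rewrite ux.
apply: contrapT => /not_support[e e0 h].
have [w [/andP[uw wv] w0] hw] := sup_adherent e0 hW.
have next y : y <= v -> y < sup W + e -> mu `]u, y]%classic = 0%E.
  move=> yv ye; have [yw|wy] := leP y w.
    apply: null_sub w0 => //= z /=; rewrite !in_itv/= => /andP[-> h1]/=.
    exact: le_trans yw.
  have -> : `]u, y]%classic = `]u, w]%classic `|` `]w, y]%classic :> set R.
    apply/seteqP; split => z /=; rewrite !in_itv/=.
      by move=> /andP[h1 h2]; have [h3|h3] := leP z w; [left|right]; rewrite ?h1 ?h2.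
    by move=> [|] /andP[h1 h2]; apply/andP; split; lra.
  have z0 : mu `]w, y]%classic = 0%E.
    by apply: null_sub h => //= z /=; rewrite !in_itv/= => /andP[h1 h2]; apply/andP; split; lra.
  apply/eqP; rewrite eq_le measure_ge0 andbT.
  apply: le_trans (measureU2 _ _ _) _ => //.
  by rewrite [X in (X + _)%E]w0 [X in (_ + X)%E]z0 adde0.
have [ve|ev] := ltP v (sup W + e).
  by move: muv; rewrite (next v (lexx _) ve) ltxx.
have hy : W (sup W + e / 2).
  split; first by apply/andP; split; lra.
  by apply: next; lra.
by have := sup_upper_bound hW hy; rewrite gerDl leNgt divr_gt0.
Qed.

Let null_gap u v : (forall x, u < x < v -> ~ S x) -> mu `]u, v[%classic = 0%E.
Proof.
(* [support_between] may return an endpoint, so the open interval is exhausted from inside. *)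
move=> h; pose A n := `]u + n.+1%:R^-1, v - n.+1%:R^-1]%classic : set R.
have A0 n : mu (A n) = 0%E.
  apply/eqP; rewrite eq_le measure_ge0 andbT leNgt; apply/negP => /support_between[x Sx].
  have : 0 < n.+1%:R^-1 :> R by rewrite invr_gt0.
  by set e := _^-1 => e0 hx; apply: (h x) => //; move/andP: hx => [h1 h2]; apply/andP; split; lra.
have sub : `]u, v[%classic `<=` \bigcup_n A n.
  move=> x /=; rewrite in_itv/= => /andP[ux xv].
  pose e := Num.min (x - u) (v - x).
  have e0 : 0 < e by rewrite lt_min !subr_gt0 ux xv.
  exists (Num.bound e^-1) => //; rewrite /A/= in_itv/=.
  have he : (Num.bound e^-1).+1%:R^-1 < e.
    rewrite invf_plt ?posrE//; apply: lt_le_trans (archi_boundP _) _.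
      by rewrite invr_ge0 ltW.
    by rewrite ler_nat.
  have [e1 e2] : e <= x - u /\ e <= v - x by split; rewrite /e ge_min lexx ?orbT.
  by move: he; set k := _^-1 => he; apply/andP; split; lra.
have mA : measurable (\bigcup_n A n).
  by apply: bigcup_measurable => n _; exact: measurable_itv.
apply: null_sub sub _ => //; apply/eqP; rewrite eq_le measure_ge0 andbT.
apply: le_trans (measure_sigma_subadditive _ _ mA (@subset_refl _ _)) _.
  by move=> n; exact: measurable_itv.
by rewrite eseries0// => n _ _; exact: A0.
Qed.

(** The potential is nonnegative, so c <= q N x^(-s) on the support; since c > 0 this bounds N x. *)
Let support_bounded x : S x -> `|x - a| <= (c / q) `^ (- s^-1).
Proof.
move=> /le_on_support h; apply: le_trans (dist_charge_sub a b x) _.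
have : c <= q * N x `^ (- s).
  by rewrite -lee_fin (le_trans _ h)// -[leLHS]add0e leeD2r// potential_ge0.
rewrite -ler_pdivrMl// mulrC => h1.
have cq : 0 < c / q by rewrite divr_gt0.
have -> : N x = (N x `^ (- s)) `^ (- s^-1).
  by rewrite -powRrM mulrNN mulfV ?gt_eqF// powRr1// ltW.
by apply: le0_powR => //; rewrite oppr_le0 invr_ge0 ltW.
Qed.

Lemma support_itv : exists al be : R, al < be /\ S = `[al, be]%classic.
Proof.
have Sne : S !=set0.
  have cv : mu `](- n%:R)%R, n%:R]%classic @[n --> \oo] -->
      mu (\bigcup_n `](- n%:R)%R, n%:R]%classic).
    apply: nondecreasing_cvg_mu => //; last exact: nondecreasing_itv_oc.
    exact: bigcup_measurable.
  apply: contrapT => S0.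
  have z n : mu `](- n%:R)%R, n%:R]%classic = 0%E.
    apply/eqP; rewrite eq_le measure_ge0 andbT leNgt; apply/negP => /support_between[x Sx _].
    by apply: S0; exists x.
  have : (0 : \bar R) = 1%E.
    rewrite -muT -(itv_oc_bigcup R) -(cvg_lim _ cv)//.
    by under eq_fun do rewrite z; rewrite lim_cst.
  by move=> /eqP; rewrite eq_sym onee_eq0.
pose K := (c / q) `^ (- s^-1).
have Sb x : S x -> a - K <= x <= a + K.
  by move=> /support_bounded; rewrite -/K ler_norml; lra.
have sup_in (T : set R) : T `<=` S -> has_sup T -> S (sup T).
  move=> TS hT; apply: contrapT => /not_support_nbhd[e e0 h].
  have [y Ty hy] := sup_adherent e0 hT; apply: (h y); last exact: TS.
  by rewrite ler0_norm ?subr_le0 ?(sup_upper_bound hT)// opprB; lra.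
have inf_in (T : set R) : T `<=` S -> has_inf T -> S (inf T).
  move=> TS hT; apply: contrapT => /not_support_nbhd[e e0 h].
  have [y Ty hy] := inf_adherent e0 hT; apply: (h y); last exact: TS.
  by have := ge_inf hT.2 Ty; move: hy; set i := inf T => hy ?; rewrite ger0_norm; lra.
have hsS : has_sup S by split => //; exists (a + K) => x /Sb/andP[].
have hiS : has_inf S by split => //; exists (a - K) => x /Sb/andP[].
have Sal := inf_in S (@subset_refl _ _) hiS.
have Sbe := sup_in S (@subset_refl _ _) hsS.
have albe : inf S <= sup S by exact: sup_upper_bound.
exists (inf S), (sup S); split.
  (* A support reduced to one point would have to be an atom. *)
  rewrite lt_neqAle albe andbT; apply/eqP => E.
  have Sx x : S x -> x = inf S.
    move=> h; apply/eqP; rewrite eq_le (ge_inf hiS.2)// andbT E.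
    exact: (sup_upper_bound hsS).
  have z1 : mu `](inf S - 1)%R, (inf S)[%classic = 0%E.
    by apply: null_gap => x hx /Sx xE; move: hx; rewrite xE ltxx andbF.
  have z2 : mu `](inf S), (inf S + 1)%R[%classic = 0%E.
    by apply: null_gap => x hx /Sx xE; move: hx; rewrite xE ltxx.
  have := Sal 1 ltr01.
  have -> : `](inf S - 1)%R, (inf S + 1)%R[%classic =
      `](inf S - 1)%R, (inf S)[%classic `|` ([set inf S] `|` `](inf S), (inf S + 1)%R[%classic) :> set R.
    apply/seteqP; split => z /=; rewrite !in_itv/=.
      by move=> /andP[h1 h2]; case: (ltgtP z (inf S)) => h3;
        [left; rewrite h1|right; right; rewrite h2|right; left].
    by move=> [/andP[h1 h2]|[->|/andP[h1 h2]]]; apply/andP; split; lra.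
  apply/negP; rewrite -leNgt; apply: le_trans (measureU2 _ _ _) _ => //.
    exact: measurableU.
  rewrite [X in (X + _)%E]z1 add0e; apply: le_trans (measureU2 _ _ _) _ => //.
  by rewrite [X in (_ + X)%E]z2 [X in (X + _)%E]finite_energy_not_atom adde0.
apply/seteqP; split => x /=; rewrite in_itv/=.
  by move=> Sx; rewrite (ge_inf hiS.2)// (sup_upper_bound hsS).
move=> /andP[alx xbe]; apply: contrapT => nSx.
(* The nearest support points on either side of [x] bound a maximal gap, to which [gap_lt]
   applies. *)
pose L := [set y | S y /\ y <= x]; pose T := [set y | S y /\ x <= y].
have hL : has_sup L by split; [exists (inf S)|exists x => y []].
have hT : has_inf T by split; [exists (sup S)|exists x => y []].
have SL : S (sup L) by apply: sup_in => // y [].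
have ST : S (inf T) by apply: inf_in => // y [].
have Lx : sup L <= x by apply: ge_sup; [exists (inf S)|move=> y []].
have xT : x <= inf T by apply: lb_le_inf; [exists (sup S)|move=> y []].
have Lx' : sup L < x by rewrite lt_neqAle Lx andbT; apply/eqP => h; apply: nSx; rewrite -h.
have xT' : x < inf T by rewrite lt_neqAle xT andbT; apply/eqP => h; apply: nSx; rewrite h.
have mu0 : mu `](sup L), (inf T)[%classic = 0%E.
  apply: null_gap => y /andP[h1 h2] Sy; have [yx|xy] := leP y x.
    by move: h1; rewrite ltNge (sup_upper_bound hL).
  by move: h2; rewrite ltNge (ge_inf hT.2)//; split => //; exact: ltW.
have [y yLT hy] := frostman_ge (lt_trans Lx' xT').
have := gap_lt yLT mu0 (le_on_support SL) (le_on_support ST).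
by rewrite ltNge hy.
Qed.

End support_interval.

(** * Dilations and the two regimes *)

Section dilation.
Variables (R : realType) (s : R).

Definition dilation (k x : R) : R := k * x.

Let measurable_dilation k : measurable_fun setT (dilation k).
Proof. by apply: measurable_funM. Qed.

HB.instance Definition _ k :=
  isMeasurableFun.Build _ _ _ _ (dilation k) (measurable_dilation k).

Lemma riesz_kernel_dilation k x y : 0 < k ->
  riesz_kernel s (dilation k x) (dilation k y) = ((k `^ (- s))%:E * riesz_kernel s x y)%E.
Proof.
move=> k0; rewrite /riesz_kernel /dilation (inj_eq (mulfI (lt0r_neq0 k0))).
case: ifP => _; first by rewrite gt0_muley// lte_fin powR_gt0.
by rewrite -mulrBr normrM (gtr0_norm k0) powRM ?(ltW k0).
Qed.

Lemma riesz_energy_dilation (sigma : probability R R) k : 0 < k ->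
  riesz_energy s (distribution sigma (dilation k)) =
  ((k `^ (- s))%:E * riesz_energy s sigma)%E.
Proof.
move=> k0.
have U0 (nu : probability R R) x : (0 <= \int[nu]_y riesz_kernel s x y)%E.
  exact: potential_ge0.
have mU (nu : probability R R) : measurable_fun setT (fun x => \int[nu]_y riesz_kernel s x y)%E.
  exact: measurable_potential.
rewrite /riesz_energy ge0_integral_distribution//.
rewrite -ge0_integralZl ?lee_fin ?powR_ge0//.
apply: eq_integral => x _ /=.
rewrite ge0_integral_distribution//; last 2 first.
- exact: measurable_riesz_kernel1.
- by move=> y; exact: riesz_kernel_ge0.
rewrite -ge0_integralZl ?lee_fin ?powR_ge0//; last 2 first.
- exact: measurable_riesz_kernel1.
- by move=> y _; exact: riesz_kernel_ge0.
by apply: eq_integral => y _ /=; exact: riesz_kernel_dilation.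
Qed.

End dilation.

Section spread.
Variables (R : realType) (s q a b : R).
Hypotheses (s_gt0 : 0 < s) (q_gt0 : 0 < q) (q_lt1 : q < 1) (b_neq0 : b != 0).
Variable sigma : probability R R.
Hypothesis sigma_potential :
  forall x, (\int[sigma]_y riesz_kernel s x y = (dist_charge a b x `^ (- s))%:E)%E.
Local Notation leb2 := (@leb2 R).
Local Notation tr := (@trace R s).

(* The mass missing from [q sigma] is dilated to infinity at vanishing energy cost. *)
Lemma energy_gap_spread e : 0 < e ->
  exists nu : probability R R, L2 leb2 (tr nu) /\ energy_gap s q sigma nu <= e.
Proof.
move=> e0; have Ls : L2 leb2 (tr sigma) by exact: L2_trace_sigma sigma_potential.
pose I := L2ip leb2 (tr sigma) (tr sigma).
have I0 : 0 <= I by exact: L2ip_ge0.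
pose D := (1 - q) ^+ 2 * I.
have D0 : 0 <= D by rewrite mulr_ge0// sqr_ge0.
have eD0 : 0 < e / (D + 1) by rewrite divr_gt0// ltr_wpDl.
(* Dilation by k multiplies energy by k^(-s) = e / (D + 1), so the final gap is e D / (D + 1) <= e;
   the + 1 keeps the denominator positive. *)
pose k := (e / (D + 1)) `^ (- s^-1).
have k0 : 0 < k by exact: powR_gt0.
have kE : k `^ (- s) = e / (D + 1).
  by rewrite -powRrM mulrNN mulVf ?gt_eqF// powRr1// ltW.
pose rho := distribution sigma (dilation k).
have rhoI : (\int[rho]_x \int[rho]_y riesz_kernel s x y = (e / (D + 1) * I)%:E)%E.
  rewrite EFinM -kE -mutual_energy_L2ip//; exact: riesz_energy_dilation.
have Lr : L2 leb2 (tr rho) by apply/(L2_trace s_gt0); rewrite rhoI ltry.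
have q'0 : 0 <= 1 - q by rewrite subr_ge0 ltW.
have [m mE] := finite_measure_combination sigma rho (ltW q_gt0) q'0.
have mT : m setT = 1%E.
  rewrite mE// [X in (_ * X + _)%E]probability_setT [X in (_ + _ * X)%E]probability_setT.
  by rewrite !mule1 -EFinD addrC subrK.
have [nu nuE] := probability_of_measure mT.
have trE : tr nu = (fun p => q * tr sigma p + (1 - q) * tr rho p).
  by rewrite nuE; exact: trace_combination.
exists nu; split; first by rewrite trE; apply: L2D; exact: L2Z.
have VE : signed_trace s q sigma nu = (fun p => (1 - q) * tr rho p).
  by apply/funext => p; rewrite /signed_trace trE addrAC subrr add0r.
rewrite /energy_gap VE L2ipZl//; last exact: L2Z.
rewrite L2ipC L2ipZl//.
have -> : L2ip leb2 (tr rho) (tr rho) = e / (D + 1) * I.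
  by apply: EFin_inj; rewrite -rhoI mutual_energy_L2ip.
have -> : (1 - q) * ((1 - q) * (e / (D + 1) * I)) = e * (D / (D + 1)).
  by rewrite /D; ring.
by rewrite ger_pMr// ler_pdivrMr ?mul1r ?lerDl// ltr_wpDl.
Qed.

End spread.

Section equilibrium_gap.
Variables (R : realType) (s q a b : R).
Hypotheses (s_gt0 : 0 < s) (q_gt0 : 0 < q) (b_neq0 : b != 0).
Variable sigma : probability R R.
Hypothesis sigma_potential :
  forall x, (\int[sigma]_y riesz_kernel s x y = (dist_charge a b x `^ (- s))%:E)%E.
Local Notation leb2 := (@leb2 R).
Local Notation tr := (@trace R s).

(** [sigma] has finite weighted energy, so a minimizer has finite Riesz energy, and competitors of
    infinite energy are harmless. *)
Lemma is_equilibriumP (mu : probability R R) : is_equilibrium s q a b mu <->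
  L2 leb2 (tr mu) /\ forall nu : probability R R, L2 leb2 (tr nu) ->
    energy_gap s q sigma mu <= energy_gap s q sigma nu.
Proof.
have E := weighted_energyE q s_gt0 b_neq0 sigma_potential.
split=> [h|[Lm h] nu].
  have Lm : L2 leb2 (tr mu).
    apply: contrapT => nL; have := h sigma.
    rewrite (weighted_energy_pinfty q a s_gt0 b_neq0 nL) E//.
    exact: L2_trace_sigma sigma_potential.
  by split=> // nu Ln; have := h nu; rewrite !E// lee_fin lerD2r.
have [Ln|nL] := pselect (L2 leb2 (tr nu)); first by rewrite !E// lee_fin lerD2r h.
by rewrite (weighted_energy_pinfty q a s_gt0 b_neq0 nL) leey.
Qed.

End equilibrium_gap.

Theorem theorem2p1 (R : realType) (s q a b : R)
  (hs0 : 0 < s) (hs1 : s < 1) (hq : 0 < q) (hb : b != 0) :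
  (1 < q ->
     (exists mu : probability R R,
        is_equilibrium s q a b mu /\
        (forall mu' : probability R R, is_equilibrium s q a b mu' ->
           forall A : set R, measurable A -> mu' A = mu A) /\
        (exists c d : R, c < d /\ msupport mu = `[c, d]%classic)))
  /\
  (q < 1 -> ~ exists mu : probability R R, is_equilibrium s q a b mu).
Proof.
have [sigma [sP sigma_gt0]] := riesz_balayage hs1 a hb.
have eqP := is_equilibriumP q hs0 hb sP.
split=> [q1|q1 [mu /eqP[Lm mu_min]]].
  have [m [m1 Lm m_min]] := energy_gap_minimizer q hs0 hb sP.
  have mT := minimizer_mass hs0 hq hb sP m1 Lm m_min q1.
  have [mu muE] := probability_of_measure mT.
  exists mu; split; last split.
  - apply/eqP; rewrite muE; split=> // nu Ln.
    by apply: m_min => //; exact: probability_le1.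
  - move=> nu /eqP[Ln nu_min] A mA; rewrite muE.
    apply: (minimizer_strict hs0 hb sP m1 Lm m_min) => //.
      exact: probability_le1.
    by have := nu_min mu; rewrite muE; exact.
  - rewrite /msupport muE.
    apply: (support_itv hs0 hq hb (frostman_constant_gt0 hs0 hq hb sP m1 Lm m_min q1) mT).
    + exact: potential_integrable.
    + exact: (frostman_le hs0 hq hb sP m1 Lm m_min q1).
    (* [sigma] charges every open interval, so the lower Frostman inequality holds on a dense
       set. *)
    + move=> u v uv; have [//|x] := frostman_ge hs0 hq hb sP m1 Lm m_min q1 _ (sigma_gt0 _ _ uv).
      by rewrite /= in_itv/= => xuv hx; exists x.
have g0 : energy_gap s q sigma mu <= 0.
  apply/ler_addgt0Pr => e e0; rewrite add0r.
  have [nu [Ln]] := energy_gap_spread hs0 hq q1 hb sP e0.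
  exact/le_trans/mu_min.
have := energy_gap_gt0 hs0 hq hb sP Lm; rewrite ltNge g0 => h.
suff : false by []; apply: h.
by rewrite [LHS]probability_setT => -[/esym q1']; move: q1; rewrite q1' ltxx.
Qed.
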